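(* $\mathsf{CONSTRAINT\_FIND}$ runs in polynomial time if at least one of the following conditions holds: (i) the intersection graph has $O(\log n)$ nodes; (ii) the intersection graph has constant maximum degree and a constant number of nodes with degree at least $3$.
   Context: There are $n$ targets $T=\{t_1,\dots,t_n\}$ and $k<n$ inspection resources $s_1,\dots,s_k$. A set $R$ of pairs is given, where $(j,i)\in R$ means resource $s_j$ cannot audit target $t_i$. Each target $t_i$ has an associated variable $p_i$. $\mathsf{CONSTRAINT\_FIND}(T,R)$: let $F(t_\ell)=\{s_j : (j,\ell)\notin R\}$. Merge targets having the same value of $F$ into single nodes; for a node $v$ let $F(v)$ be the common value and $PV(v)$ the set of variables $p_i$ of the targets merged into $v$. Form the intersection graph $G$ on these nodes, two distinct nodes $v,v'$ being adjacent iff $F(v)\cap F(v')\ne\emptyset$. Compute the list of all connected induced subgraphs of $G$ (by a subroutine $\mathsf{CONNECTEDSUBGRAPHS}(G)$, whose implementation is left open). For each of them, with vertex set $V$, let $P=\bigcup_{v\in V}PV(v)$ and $\kappa=\left|\bigcup_{v\in V}F(v)\right|$; if $|P|>\kappa$, add the constraint $\sum_{p\in P}p\le\kappa$ to the output set $C$. Return $C$. ''Polynomial time'' means polynomial in the size of the instance ($n$ and $k$); ''constant'' and $O(\cdot)$ refer to a family of instances with $n$ growing. Since the subroutine's implementation is left open, ''runs in polynomial time'' means that the algorithm, including this enumeration, can be carried out in polynomial time. *)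

(* Defs.v *)
From mathcomp Require Import all_boot.

Set Implicit Arguments.
Unset Strict Implicit.
Unset Printing Implicit Defensive.

(* Model of computation: the language WHILE over binary trees (N. D. Jones,
   "Computability and Complexity from a Programming Perspective"), with its
   usual unit-cost time measure, which is polynomially related to Turing
   machine time. Tree equality is not a primitive, since it would not be a
   unit-cost operation. *)

Inductive tree := Nil | Cons of tree & tree.

Definition hd t := if t is Cons a _ then a else Nil.
Definition tl t := if t is Cons _ b then b else Nil.

Inductive expr :=
  | ENil
  | EVar of nat
  | ECons of expr & expr
  | EHd of expr
  | ETl of expr.

Definition store := nat -> tree.
Definition empty_store : store := fun=> Nil.
Definition upd (s : store) (x : nat) (v : tree) : store :=
  fun y => if y == x then v else s y.

Fixpoint eval (s : store) (e : expr) : tree :=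
  match e with
  | ENil => Nil
  | EVar x => s x
  | ECons e1 e2 => Cons (eval s e1) (eval s e2)
  | EHd e1 => hd (eval s e1)
  | ETl e1 => tl (eval s e1)
  end.

Fixpoint ecost (e : expr) : nat :=
  match e with
  | ENil | EVar _ => 1
  | ECons e1 e2 => (ecost e1 + ecost e2).+1
  | EHd e1 | ETl e1 => (ecost e1).+1
  end.

(* [Call x p e] is [x := p(e)] for a non-recursive procedure with body [p]. The
   body runs on a private store; variable 0 holds its argument and then its
   result. *)
Inductive com :=
  | Skip
  | Assign of nat & expr
  | Seq of com & com
  | If of expr & com & com
  | While of expr & com
  | Call of nat & com & expr.

(* [exec c s s' t]: started in store [s], command [c] halts in store [s'] after
   exactly [t] time units. Nil is "false", every other tree is "true". *)
Inductive exec : com -> store -> store -> nat -> Prop :=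
  | ExecSkip s : exec Skip s s 1
  | ExecAssign s x e : exec (Assign x e) s (upd s x (eval s e)) (ecost e).+1
  | ExecSeq c1 c2 s1 s2 s3 t1 t2 :
      exec c1 s1 s2 t1 -> exec c2 s2 s3 t2 ->
      exec (Seq c1 c2) s1 s3 (t1 + t2).+1
  | ExecIfTrue e c1 c2 s s' t :
      eval s e <> Nil -> exec c1 s s' t ->
      exec (If e c1 c2) s s' (ecost e + t).+1
  | ExecIfFalse e c1 c2 s s' t :
      eval s e = Nil -> exec c2 s s' t ->
      exec (If e c1 c2) s s' (ecost e + t).+1
  | ExecWhileTrue e c s1 s2 s3 t1 t2 :
      eval s1 e <> Nil -> exec c s1 s2 t1 -> exec (While e c) s2 s3 t2 ->
      exec (While e c) s1 s3 (ecost e + t1 + t2).+1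
  | ExecWhileFalse e c s :
      eval s e = Nil -> exec (While e c) s s (ecost e).+1
  | ExecCall x p e s s' t :
      exec p (upd empty_store 0 (eval s e)) s' t ->
      exec (Call x p e) s (upd s x (s' 0)) (ecost e + t).+1.

Lemma exec_det c s s1 s2 t1 t2 :
  exec c s s1 t1 -> exec c s s2 t2 -> s1 = s2 /\ t1 = t2.
Proof.
move=> H; move: s2 t2; elim: {c s s1 t1} H => [s|s x e
  |c1 c2 s1 s2 s3 t1 t2 _ IH1 _ IH2|e c1 c2 s s' t He _ IH
  |e c1 c2 s s' t He _ IH|e c s1 s2 s3 t1 t2 He _ IH1 _ IH2|e c s He
  |x p e s s' t _ IH] s4 t4 H; inversion H; subst => //;
repeat match goal with
  | IH : forall s t, exec ?c ?s0 s t -> _, E : exec ?c ?s0 _ _ |- _ =>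
      case: (IH _ _ E) => ? ?; clear IH; subst
  end; by [].
Qed.

Definition run (p : com) (input output : tree) (t : nat) : Prop :=
  exists2 s : store, exec p (upd empty_store 0 input) s t & s 0 = output.

(* Data representations. Numbers are unary (running times are measured in n and
   k, not in their bit lengths). A set is represented by a duplicate-free list
   of its elements, in any order. *)

Fixpoint nat_tree (m : nat) : tree :=
  if m is m'.+1 then Cons Nil (nat_tree m') else Nil.

Definition rep_nat (m : nat) (x : tree) : Prop := x = nat_tree m.

Definition rep_ord m (i : 'I_m) (x : tree) : Prop := rep_nat i x.

Definition rep_pair A B (rA : A -> tree -> Prop) (rB : B -> tree -> Prop)
    (p : A * B) (x : tree) : Prop :=
  exists a b, [/\ x = Cons a b, rA p.1 a & rB p.2 b].

Fixpoint rep_seq A (rA : A -> tree -> Prop) (s : seq A) (x : tree) : Prop :=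
  if s is a :: s' then
    exists y z, [/\ x = Cons y z, rA a y & rep_seq rA s' z]
  else x = Nil.

Definition rep_set (A : eqType) (rA : A -> tree -> Prop) (S : {pred A})
    (x : tree) : Prop :=
  exists s : seq A, [/\ uniq s, s =i S & rep_seq rA s x].

Definition rep_finset (T : finType) (rT : T -> tree -> Prop) (S : {set T})
    (x : tree) : Prop :=
  rep_set rT (mem S) x.

Definition rep_ordset m : {set 'I_m} -> tree -> Prop := rep_finset (@rep_ord m).

(* Connected induced subgraphs, given by their (nonempty) vertex sets, of the
   graph with vertex set [D] and adjacency relation [e]. *)

Definition induces_connected (T : finType) (e : rel T) (V : {set T}) : bool :=
  (V != set0) &&
  [forall x in V, forall y in V,
     connect [rel u w | [&& u \in V, w \in V & e u w]] x y].

Definition connected_subgraphs (T : finType) (D : {set T}) (e : rel T)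
    : {set {set T}} :=
  [set V : {set T} | (V \subset D) && induces_connected e V].

Definition rep_graph m (e : rel 'I_m) (x : tree) : Prop :=
  rep_pair rep_nat (rep_finset (rep_pair (@rep_ord m) (@rep_ord m)))
    (m, [set p : 'I_m * 'I_m | e p.1 p.2]) x.

(* [(j, i) \in cannot_audit I]: resource j cannot audit target i. *)
Record instance := Instance {
  ntargets : nat;
  nresources : nat;
  cannot_audit : {set 'I_nresources * 'I_ntargets};
  nresources_lt : nresources < ntargets
}.

Section ConstraintFind.
Variable I : instance.

Definition F (l : 'I_(ntargets I)) : {set 'I_(nresources I)} :=
  [set j | (j, l) \notin cannot_audit I].

(* A node is the set of targets merged into it. *)
Definition nodes : {set {set 'I_(ntargets I)}} := preim_partition F setT.

(* The common value of [F] on the targets of a node, see [nodeFE]. *)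
Definition nodeF (v : {set 'I_(ntargets I)}) : {set 'I_(nresources I)} :=
  \bigcup_(l in v) F l.

Lemma nodeFE v l : v \in nodes -> l \in v -> nodeF v = F l.
Proof.
move=> vN lv; case/imsetP: vN lv => x _ ->; rewrite inE => /andP[_ /eqP xl].
apply/setP=> j; apply/bigcupP/idP => [[l']|jl].
  by rewrite inE => /andP[_ /eqP xl']; rewrite -xl' xl.
by exists l => //; rewrite inE xl eqxx inE.
Qed.

(* The variable of target i is identified with the index i. *)
Definition PV (v : {set 'I_(ntargets I)}) : {set 'I_(ntargets I)} := v.

Definition adjacent : rel {set 'I_(ntargets I)} :=
  fun v w => (v != w) && (nodeF v :&: nodeF w != set0).

Definition degree (v : {set 'I_(ntargets I)}) : nat :=
  #|[set w in nodes | adjacent v w]|.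

Definition max_degree : nat := \max_(v in nodes) degree v.

Definition variables (V : {set {set 'I_(ntargets I)}}) : {set 'I_(ntargets I)} :=
  \bigcup_(v in V) PV v.

Definition kappa (V : {set {set 'I_(ntargets I)}}) : nat :=
  #|\bigcup_(v in V) nodeF v|.

(* The constraint [\sum_(p in P) p <= c] is the pair [(P, c)]. *)
Definition constraints : seq ({set 'I_(ntargets I)} * nat) :=
  [seq (variables V, kappa V) |
     V <- enum (connected_subgraphs nodes adjacent) &
     kappa V < #|variables V|].

(* The intersection graph, its nodes being numbered by their positions in [ns]. *)
Definition numbered_adjacent (ns : seq {set 'I_(ntargets I)})
    : rel 'I_(size ns) :=
  fun i j => adjacent (nth set0 ns i) (nth set0 ns j).

Definition numbers_nodes (ns : seq {set 'I_(ntargets I)}) : Prop :=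
  uniq ns /\ ns =i nodes.

Definition rep_instance (x : tree) : Prop :=
  rep_pair rep_nat
    (rep_pair rep_nat (rep_finset (rep_pair (@rep_ord _) (@rep_ord _))))
    (ntargets I, (nresources I, cannot_audit I)) x.

Definition rep_node (v : {set 'I_(ntargets I)}) (x : tree) : Prop :=
  rep_pair (@rep_ordset _) (@rep_ordset _) (PV v, nodeF v) x.

Definition rep_constraints (x : tree) : Prop :=
  rep_set (rep_pair (@rep_ordset _) rep_nat) (mem constraints) x.

End ConstraintFind.

Arguments numbered_adjacent {I} ns _ _.

(* (T, R) |-> (list of nodes v with PV(v) and F(v), intersection graph). *)
Definition builds_intersection_graph (p : com) : Prop :=
  forall (I : instance) (x : tree), rep_instance I x ->
  exists (ns : seq {set 'I_(ntargets I)}) (a b : tree) (t : nat),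
    [/\ run p x (Cons a b) t, numbers_nodes ns, rep_seq (@rep_node I) ns a
      & rep_graph (numbered_adjacent ns) b].

Definition implements_connectedsubgraphs (p : com) : Prop :=
  forall (m : nat) (e : rel 'I_m), symmetric e -> irreflexive e ->
  forall x : tree, rep_graph e x ->
  exists (y : tree) (t : nat),
    run p x y t /\ rep_finset (@rep_ordset m) (connected_subgraphs setT e) y.

(* (list of nodes, list of connected induced subgraphs) |-> C. *)
Definition collects_constraints (p : com) : Prop :=
  forall (I : instance) (ns : seq {set 'I_(ntargets I)}) (a b : tree),
  numbers_nodes ns -> rep_seq (@rep_node I) ns a ->
  rep_finset (@rep_ordset _) (connected_subgraphs setT (numbered_adjacent ns)) b ->
  exists (y : tree) (t : nat), run p (Cons a b) y t /\ rep_constraints I y.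

Definition CONSTRAINT_FIND (build connectedsubgraphs collect : com) : com :=
  Seq (Call 1 build (EVar 0))
 (Seq (Call 2 connectedsubgraphs (ETl (EVar 1)))
      (Call 0 collect (ECons (EHd (EVar 1)) (EVar 2)))).

(* [O(log n)] over a family of instances; [trunc_log 2 n] is the integer part of
   the binary logarithm, and the threshold [n0] removes the case n = 1. *)

Definition log_many_nodes (family : instance -> Prop) : Prop :=
  exists c n0 : nat, forall I : instance, family I -> n0 <= ntargets I ->
    #|nodes I| <= c * trunc_log 2 (ntargets I).

Definition constant_degree_and_branching (family : instance -> Prop) : Prop :=
  exists D h : nat, forall I : instance, family I ->
    max_degree I <= D /\ #|[set v in nodes I | 3 <= degree v]| <= h.

(* [exec] is deterministic ([exec_det]), so [t] is the running time. *)
Definition runs_in_polynomial_time (p : com) (family : instance -> Prop) : Prop :=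
  exists c d : nat, forall (I : instance) (x : tree),
    family I -> rep_instance I x ->
  exists (y : tree) (t : nat),
    [/\ run p x y t, rep_constraints I y
      & t <= c * (ntargets I + nresources I) ^ d].

(* Main.v *)
Require Import Defs.
From mathcomp Require Import all_boot.
From mathcomp Require Import zify.
Import Defs.

Set Implicit Arguments.
Unset Strict Implicit.
Unset Printing Implicit Defensive.

(* The connected sets are enumerated by starting from the singletons and, m times,
   adding to each set found so far every vertex adjacent to it and removing the
   duplicates. All intermediate lists contain only connected sets, so the running
   time is polynomial in m and the number of connected sets, and it remains to
   bound that number. In case (i) it is at most 2^m. In case (ii), with
   maximum degree D and h nodes of degree at least 3, adding to a connected set a
   neighbour of degree at most 2 does not enlarge the outer
   boundary, so every connected set has at most 2 + D h boundary vertices; as it is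
   the component of any of its vertices in the complement of its boundary, there
   are at most m (m + 1)^(2 + D h) connected sets. *)

(** * Polynomial bounds *)

(** The statement asks for actual WHILE programs, but none is written for the algorithm as a whole.
    Polynomial time is made a property [polytime] of functions between types encoded as trees,
    closed under composition, pairing, branching and suitable folds; the algorithm is an ordinary
    function on lists of numbers, and its programs come out of the closure lemmas. The obstacle is
    iteration: repeating a polynomial-time step need not stay polynomial, since the accumulator may
    grow. Steps that add a bounded part are harmless. The enumeration step can multiply its list, so
    its cost is measured against the sizes of all intermediate lists, and these are bounded only
    afterwards. The programs do not depend on the family of instances, which enters only through the
    number of connected sets. *)

Definition polynomially_bounded (q : nat -> nat) : Prop :=
  {homo q : a b / a <= b} /\ exists c d, forall s, q s <= c * s.+1 ^ d.

Lemma polynomially_bounded_const c : polynomially_bounded (fun=> c).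
Proof. by split=> //; exists c, 0 => s; rewrite expn0 muln1. Qed.

Lemma polynomially_bounded_id : polynomially_bounded id.
Proof. by split=> //; exists 1, 1 => s; rewrite mul1n expn1. Qed.

Lemma polynomially_bounded_add q r :
  polynomially_bounded q -> polynomially_bounded r ->
  polynomially_bounded (fun s => q s + r s).
Proof.
move=> [qm [c [d qle]]] [rm [c' [d' rle]]]; split=> [a b ab|].
  exact: leq_add (qm _ _ ab) (rm _ _ ab).
exists (c + c'), (d + d') => s; rewrite mulnDl; apply: leq_add.
  by apply: leq_trans (qle s) _; rewrite leq_mul2l leq_pexp2l ?leq_addr ?orbT.
by apply: leq_trans (rle s) _; rewrite leq_mul2l leq_pexp2l ?leq_addl ?orbT.
Qed.

Lemma polynomially_bounded_mul q r :
  polynomially_bounded q -> polynomially_bounded r ->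
  polynomially_bounded (fun s => q s * r s).
Proof.
move=> [qm [c [d qle]]] [rm [c' [d' rle]]]; split=> [a b ab|].
  exact: leq_mul (qm _ _ ab) (rm _ _ ab).
exists (c * c'), (d + d') => s; rewrite expnD mulnACA; exact: leq_mul.
Qed.

Lemma polynomially_bounded_comp q r :
  polynomially_bounded q -> polynomially_bounded r ->
  polynomially_bounded (fun s => q (r s)).
Proof.
move=> [qm [c [d qle]]] [rm [c' [d' rle]]]; split=> [a b ab|].
  exact: qm (rm _ _ ab).
(* [c'.+1] absorbs the successor in [(r s).+1], because [s.+1 ^ d'] is at least 1. *)
exists (c * c'.+1 ^ d), (d' * d) => s; apply: leq_trans (qle _) _.
rewrite -mulnA leq_mul2l expnM -expnMn; apply/orP; right.
case: d {qle} => [|d]; first by rewrite !expn0.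
rewrite leq_exp2r // mulSn addnC -addn1 leq_add ?expn_gt0 //.
Qed.

Ltac polynomially_bounded :=
  repeat first
    [ assumption
    | apply: polynomially_bounded_id
    | apply: polynomially_bounded_const
    | apply: polynomially_bounded_add
    | apply: polynomially_bounded_mul
    | match goal with
      | H : polynomially_bounded ?q |- polynomially_bounded (fun s => ?q (@?r s)) =>
          apply: (polynomially_bounded_comp (q := q) (r := r) H)
      end ].

(** * Programs with polynomial running time *)

Fixpoint tree_size (x : tree) : nat :=
  if x is Cons a b then (tree_size a + tree_size b).+1 else 1.

Lemma tree_size_gt0 x : 0 < tree_size x. Proof. by case: x. Qed.

Class encodable (A : Type) := enc : A -> tree.

(** The codes overlap on purpose: 0, [false] and the empty list are all [Nil], a number is coded as
    the list of as many [false], and [a :: s] as the pair [(a, s)]. Passing between these views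
    costs nothing. *)
#[export] Instance encodable_nat : encodable nat := nat_tree.
#[export] Instance encodable_bool : encodable bool :=
  fun b => if b then Cons Nil Nil else Nil.
#[export] Instance encodable_prod A B `{encodable A} `{encodable B} :
  encodable (A * B) := fun x => Cons (enc x.1) (enc x.2).
#[export] Instance encodable_seq A `{encodable A} : encodable (seq A) :=
  fix enc_seq s := if s is a :: s' then Cons (enc a) (enc_seq s') else Nil.

Lemma tree_size_nat i : tree_size (enc i) = 2 * i + 1.
Proof. by elim: i => //= i; rewrite mulnS => ->; lia. Qed.

(* The size of the output is bounded along with the time: sharing lets a unit-cost
   program build trees of exponential size in linear time. *)
Definition polytime_for A B `{encodable A} `{encodable B} (mu : A -> nat)
    (f : A -> B) : Prop :=
  exists p q, polynomially_bounded q /\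
    forall a, exists2 t, run p (enc a) (enc (f a)) t &
      t + tree_size (enc (f a)) <= q (mu a).

Notation polytime f := (polytime_for (fun a => tree_size (enc a)) f).

(** [hd] and [tl] never enlarge a tree and [ECons] adds one node to two trees, so each unit of
    [ecost] pays for at most one tree of size [b]. *)
Lemma tree_size_eval s e b : (forall x, tree_size (s x) <= b) ->
  tree_size (eval s e) <= ecost e * b.
Proof.
move=> sb; have b0 : 0 < b by apply: leq_trans (tree_size_gt0 _) (sb 0).
have hdP x : tree_size (hd x) <= tree_size x by case: x => //= x y; lia.
have tlP x : tree_size (tl x) <= tree_size x by case: x => //= x y; lia.
elim: e => [|x|e1 IH1 e2 IH2|e IH|e IH] /=; rewrite ?mul1n //.
- by lia.
- by have := hdP (eval s e); lia.
by have := tlP (eval s e); lia.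
Qed.

Section Closure.
Context {A B C : Type} `{encodable A} `{encodable B} `{encodable C}.

Lemma polytime_expr (e : expr) (f : A -> B) :
  (forall a, eval (upd empty_store 0 (enc a)) e = enc (f a)) -> polytime f.
Proof.
move=> ef; exists (Assign 0 e), (fun s => (ecost e).+1 + ecost e * s); split.
  by polynomially_bounded.
move=> a; exists (ecost e).+1.
  by exists (upd (upd empty_store 0 (enc a)) 0 (enc (f a))); first rewrite -ef; constructor.
rewrite leq_add2l -ef; apply: tree_size_eval => x.
by rewrite /upd; case: ifP; rewrite // tree_size_gt0.
Qed.

(** A program sees only codes, so even the type of the values may change. Many operations below are
    first rewritten through this lemma as folds. *)
Lemma eq_polytime_for B' `{encodable B'} (mu : A -> nat) (f : A -> B) (g : A -> B') :
  (forall a, enc (f a) = enc (g a)) -> polytime_for mu f -> polytime_for mu g.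
Proof.
move=> fg [p [q [qP pP]]]; exists p, q; split=> // a.
by have [t] := pP a; rewrite fg; exists t.
Qed.

Lemma polytime_for_le (mu nu : A -> nat) (f : A -> B) :
  (exists2 q, polynomially_bounded q & forall a, mu a <= q (nu a)) ->
  polytime_for mu f -> polytime_for nu f.
Proof.
move=> [r rP mur] [p [q [qP pP]]]; exists p, (fun s => q (r s)).
split=> [|a]; first by polynomially_bounded.
have [t tr tle] := pP a; exists t => //; apply: leq_trans tle _.
exact: qP.1 (mur a).
Qed.

Lemma polytime_comp (g : B -> C) (f : A -> B) :
  polytime g -> polytime f -> polytime (fun a => g (f a)).
Proof.
move=> [p [q [qP pP]]] [p' [q' [q'P p'P]]].
exists (Seq (Call 0 p' (EVar 0)) (Call 0 p (EVar 0))).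
exists (fun s => q' s + q (q' s) + 10); split; first by polynomially_bounded.
move=> a; have [t [s st s0] tle] := p'P a; have [u [s' su s'0] ule] := pP (f a).
have : q (tree_size (enc (f a))) <= q (q' (tree_size (enc a))).
  by apply: qP.1; apply: leq_trans tle; rewrite leq_addl.
exists ((1 + t).+1 + (1 + u).+1).+1; last by lia.
exists (upd (upd (upd empty_store 0 (enc a)) 0 (s 0)) 0 (s' 0)); last by [].
apply: ExecSeq; first exact: (@ExecCall 0 p' (EVar 0) (upd empty_store 0 (enc a)) s t st).
by rewrite -s0 in su; apply: (@ExecCall 0 p (EVar 0) _ s' u su).
Qed.

Lemma polytime_pair (f : A -> B) (g : A -> C) :
  polytime f -> polytime g -> polytime (fun a => (f a, g a)).
Proof.
move=> [p [q [qP pP]]] [p' [q' [q'P p'P]]].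
exists (Seq (Call 1 p (EVar 0)) (Seq (Call 2 p' (EVar 0))
  (Assign 0 (ECons (EVar 1) (EVar 2))))).
exists (fun s => q s + q' s + 20); split; first by polynomially_bounded.
move=> a; have [t [s st s0] tle] := pP a; have [u [s' su s'0] ule] := p'P a.
exists ((1 + t).+1 + ((1 + u).+1 + 4).+1).+1; last first.
  have -> : tree_size (enc (f a, g a)) = (tree_size (enc (f a)) + tree_size (enc (g a))).+1 by [].
  by lia.
exists (upd (upd (upd (upd empty_store 0 (enc a)) 1 (s 0)) 2 (s' 0)) 0
   (Cons (s 0) (s' 0))); last by rewrite /upd /= s0 s'0.
apply: ExecSeq; first exact: (@ExecCall 1 p (EVar 0) _ _ _ st).
apply: ExecSeq; first exact: (@ExecCall 2 p' (EVar 0) _ _ _ su).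
exact: (@ExecAssign _ 0 (ECons (EVar 1) (EVar 2))).
Qed.

Lemma polytime_if (P : A -> bool) (f g : A -> B) :
  polytime P -> polytime f -> polytime g ->
  polytime (fun a => if P a then f a else g a).
Proof.
move=> [p [q [qP pP]]] [p1 [q1 [q1P p1P]]] [p2 [q2 [q2P p2P]]].
exists (Seq (Call 1 p (EVar 0))
  (If (EVar 1) (Call 0 p1 (EVar 0)) (Call 0 p2 (EVar 0)))).
exists (fun s => q s + q1 s + q2 s + 20); split; first by polynomially_bounded.
move=> a; have [t [s st s0] tle] := pP a.
have [u1 [s1 su1 s10] u1le] := p1P a; have [u2 [s2 su2 s20] u2le] := p2P a.
exists ((1 + t).+1 + (1 + (if P a then (1 + u1).+1 else (1 + u2).+1)).+1).+1.
  exists (upd (upd (upd empty_store 0 (enc a)) 1 (s 0)) 0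
     (if P a then s1 0 else s2 0)); last by case: (P a).
  apply: ExecSeq; first exact: (@ExecCall 1 p (EVar 0) _ _ _ st).
  rewrite s0; case: (P a).
    by apply: (@ExecIfTrue (EVar 1)) => //; apply: (@ExecCall 0 p1 (EVar 0) _ _ _ su1).
  by apply: (@ExecIfFalse (EVar 1)) => //; apply: (@ExecCall 0 p2 (EVar 0) _ _ _ su2).
by case: (P a); lia.
Qed.

End Closure.

(** * Right folds *)

(* The step also receives the remaining list; the lengths of these suffixes are
   what turns a unary number n into [iota 0 n]. *)
Fixpoint para A B (h : A -> seq A -> B -> B) (z : B) (s : seq A) : B :=
  if s is a :: s' then h a s' (para h z s') else z.

Section Paramorphism.
Context {X A B : Type} `{encodable X} `{encodable A} `{encodable B}.

(* A right fold is run by two loops: the first one stacks the suffixes of the list,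
   the second one pops them, shortest first. *)
Fixpoint push_suffixes (s : seq A) (w : tree) : tree :=
  if s is a :: s' then push_suffixes s' (Cons (enc s) w) else w.

Definition push_loop : com :=
  While (EVar 1) (Seq (Assign 3 (ECons (EVar 1) (EVar 3))) (Assign 1 (ETl (EVar 1)))).

Lemma push_loopP (s : seq A) (st : store) : st 1 = enc s ->
  exists st', exec push_loop st st' (10 * size s + 2) /\
    [/\ st' 0 = st 0, st' 2 = st 2 & st' 3 = push_suffixes s (st 3)].
Proof.
elim: s st => [|a s IH] st st1; first by exists st; split=> //; apply: ExecWhileFalse.
pose st1' := upd st 3 (Cons (st 1) (st 3)).
have [|st' [ex [e0 e2 e3]]] := IH (upd st1' 1 (tl (st1' 1))).
  by rewrite /st1' /upd /= st1.
exists st'; split.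
  have -> : 10 * size (a :: s) + 2 = (1 + (4 + 3).+1 + (10 * size s + 2)).+1.
    by rewrite /=; lia.
  apply: ExecWhileTrue ex; first by rewrite /= st1.
  by apply: ExecSeq; [exact: ExecAssign | exact: (@ExecAssign _ 1 (ETl (EVar 1)))].
by split=> //; rewrite e3 /st1' /upd /= st1.
Qed.

Variable (h : X -> A -> seq A -> B -> B).
Variable (p : com) (x : X) (z : B) (k : nat).

Definition pop_loop : com :=
  While (EVar 3) (Seq (Call 2 p (ECons (EVar 0) (ECons (EHd (EVar 3)) (EVar 2))))
    (Assign 3 (ETl (EVar 3)))).

(** The loop consumes the shortest suffix first, while the induction strips the head, whose turn
    comes last. Hence the continuation form: whatever happens once [s] is used up, within [T] and
    ending in [Q], is an assumption. The step is required to run within [k] only on suffixes of [s]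
    with their true accumulators. *)
Lemma pop_loopP (Q : store -> Prop) (T : nat) (s : seq A) (w : tree) (st : store) :
    (forall i a s', drop i s = a :: s' -> exists2 t,
      run p (enc (x, (a :: s', para (h x) z s'))) (enc (h x a s' (para (h x) z s'))) t
      & t <= k) ->
    st 0 = enc x -> st 2 = enc z -> st 3 = push_suffixes s w ->
    (forall st1, st1 0 = enc x -> st1 2 = enc (para (h x) z s) -> st1 3 = w ->
      exists st2 t, [/\ exec pop_loop st1 st2 t, Q st2 & t <= T]) ->
  exists st2 t, [/\ exec pop_loop st st2 t, Q st2 & t <= T + size s * (k + 20)].
Proof.
elim: s w T st => [|a s IH] w T st step st0 st2 st3 last.
  have [st' [t [ex Qst tle]]] := last _ st0 st2 st3.
  by exists st', t; split=> //; rewrite addn0.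
(* While the tail is processed, the suffix [a :: s] still waits on the stack; its round belongs to
   the continuation, whose budget grows by [k + 20]. *)
have [||st' [t [ex Qst tle]]] := IH (Cons (enc (a :: s)) w) (T + (k + 20)) st _ st0 st2 st3.
- by move=> i b s' ds; apply: (step i.+1 b s').
- move=> st1 e0 e2 e3; have [t [s1 ex e1] tle] := step 0 a s (drop0 _).
  pose st1' := upd st1 2 (s1 0).
  have [|||st' [u [exu Qst ule]]] := last (upd st1' 3 (tl (st1' 3))).
  + by [].
  + by rewrite /st1' /upd /= e1.
  + by rewrite /st1' /upd /= e3.
  exists st', (1 + ((6 + t).+1 + 3).+1 + u).+1; split=> //; last by lia.
  apply: ExecWhileTrue exu; first by rewrite /= e3.
  apply: ExecSeq; last exact: (@ExecAssign _ 3 (ETl (EVar 3))).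
  apply: (@ExecCall 2 p (ECons (EVar 0) (ECons (EHd (EVar 3)) (EVar 2)))).
  by rewrite /= e0 e2 e3.
by exists st', t; split=> //; rewrite [size (a :: s)]/= mulSn; lia.
Qed.

End Paramorphism.

Section PolytimePara.
Context {X A B : Type} `{encodable X} `{encodable A} `{encodable B}.
Variables (h : X -> A -> seq A -> B -> B) (z : X -> B) (l : X -> seq A).

(** The measure in which every fold with a polynomial-time step is polynomial: it contains the sizes
    of all accumulators. The [.+1] in the range is for the empty suffix, that is, the initial
    value. *)
Definition para_size (x : X) : nat :=
  tree_size (enc x) +
  \sum_(i < (size (l x)).+1) tree_size (enc (para (h x) (z x) (drop i (l x)))).

Lemma tree_size_cons (a : A) s :
  tree_size (enc (a :: s)) = (tree_size (enc a) + tree_size (enc s)).+1.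
Proof. by []. Qed.

Lemma size_enc (s : seq A) : size s <= tree_size (enc s).
Proof.
elim: s => //= a s IH; exact: leq_trans IH (leq_addl _ _).
Qed.

Lemma tree_size_drop i (s : seq A) : tree_size (enc (drop i s)) <= tree_size (enc s).
Proof.
elim: s i => [|a s IH] [|i] //=; apply: leq_trans (IH i) _.
exact: leq_trans (leq_addl _ _) (leqnSn _).
Qed.

Lemma polytime_for_para :
  polytime (fun y : X * (seq A * B) =>
    if y.2.1 is a :: s then h y.1 a s y.2.2 else y.2.2) ->
  polytime z -> polytime l ->
  polytime_for para_size (fun x => para (h x) (z x) (l x)).
Proof.
move=> [p [q [qP pP]]] [pz [qz [qzP pzP]]] [pl [ql [qlP plP]]].
exists (Seq (Call 1 pl (EVar 0)) (Seq (Call 2 pz (EVar 0)) (Seq push_loop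
  (Seq (pop_loop p) (Assign 0 (EVar 2)))))).
(* The leading [s] bounds the result, itself one of the accumulators; [ql s] bounds the number of
   rounds; the argument of [q] adds up the suffix, [x], the accumulator and two pairing nodes. *)
exists (fun s => s + ql s + qz s + 10 * ql s + ql s * (q (ql s + s + s + 2) + 20) + 100).
split; first by polynomially_bounded.
move=> x; set n := para_size x.
have xn : tree_size (enc x) <= n by rewrite leq_addr.
have dn i : tree_size (enc (para (h x) (z x) (drop i (l x)))) <= n.
  suff: exists2 j, j < (size (l x)).+1 & drop i (l x) = drop j (l x).
    move=> [j jl ->]; apply: leq_trans (leq_addl _ _).
    by rewrite (bigD1 (Ordinal jl)) //; exact: leq_addr.
  have [il|il] := leqP i (size (l x)); first by exists i.
  by exists (size (l x)); rewrite // drop_size drop_oversize 1?ltnW.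
have [t [s1 ex1 e1] tle] := plP x; have [u [s2 ex2 e2] ule] := pzP x.
have {}tle : t + tree_size (enc (l x)) <= ql n by apply: leq_trans tle (qlP.1 _ _ xn).
have {}ule : u + tree_size (enc (z x)) <= qz n by apply: leq_trans ule (qzP.1 _ _ xn).
pose (st0 := upd (upd (upd empty_store 0 (enc x)) 1 (s1 0)) 2 (s2 0)).
have [|st1 [ex3 [f0 f2 f3]]] := @push_loopP A _ (l x) st0; first by rewrite /st0 /upd /= e1.
have [|||||st2 [v [ex4 f4 vle]]] := @pop_loopP X A B _ _ _ h p x (z x) (q (ql n + n + n + 2))
  (fun st => st 2 = enc (para (h x) (z x) (l x))) 2 (l x) Nil st1.
- move=> i a s' ds; have [t' r t'le] := pP (x, (a :: s', para (h x) (z x) s')).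
  exists t'; first exact: r.
  apply: leq_trans (leq_addr _ _) (leq_trans t'le (qP.1 _ _ _)).
  have ->: tree_size (enc (x, (a :: s', para (h x) (z x) s'))) =
     (tree_size (enc x) + (tree_size (enc (a :: s')) + tree_size (enc (para (h x) (z x) s'))).+1).+1 by [].
  have := tree_size_drop i (l x); rewrite ds.
  have := dn i.+1; rewrite -add1n -drop_drop ds /= drop0; lia.
- by rewrite f0.
- by rewrite f2 /st0 /upd /= e2.
- by rewrite f3.
- by move=> s3 _ s32 s33; exists s3, 2; split=> //; apply: (@ExecWhileFalse (EVar 3)).
exists ((1 + t).+1 + ((1 + u).+1 + ((10 * size (l x) + 2) + (v + 2).+1).+1).+1).+1.
  exists (upd st2 0 (st2 2)); last by rewrite /upd /= f4.
  apply: ExecSeq; first exact: (@ExecCall 1 pl (EVar 0) _ _ _ ex1).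
  apply: ExecSeq; first exact: (@ExecCall 2 pz (EVar 0) _ _ _ ex2).
  apply: ExecSeq; first exact: ex3.
  by apply: ExecSeq; [exact: ex4 | exact: (@ExecAssign _ 0 (EVar 2))].
have := dn 0; rewrite drop0; have := size_enc (l x).
have : size (l x) * (q (ql n + n + n + 2) + 20) <= ql n * (q (ql n + n + n + 2) + 20).
  by rewrite leq_mul2r (leq_trans (size_enc _)) ?orbT // (leq_trans _ tle) ?leq_addl.
lia.
Qed.

(* Steps that only add to the accumulator a part bounded in terms of the other
   arguments can be iterated; a step that multiplied its size could not. *)
Lemma polytime_additive_growth (g : nat -> nat) : polynomially_bounded g ->
  (forall x a s b,
    tree_size (enc (h x a s b)) <= tree_size (enc b) + g (tree_size (enc (x, a :: s)))) ->
  polytime (fun y : X * (seq A * B) =>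
    if y.2.1 is a :: s then h y.1 a s y.2.2 else y.2.2) ->
  polytime z -> polytime l -> polytime (fun x => para (h x) (z x) (l x)).
Proof.
move=> gP hg hP zP lP; apply: polytime_for_le (polytime_for_para hP zP lP).
have [pz [qz [qzP pzP]]] := zP; have [pl [ql [qlP plP]]] := lP.
exists (fun s => s + (1 + ql s) * (qz s + ql s * g (s + ql s + 1))).
  by polynomially_bounded.
move=> x; rewrite leq_add2l; set n := tree_size (enc x).
have lsize : tree_size (enc (l x)) <= ql n.
  by have [t _] := plP x; apply: leq_trans; rewrite leq_addl.
have zsize : tree_size (enc (z x)) <= qz n.
  by have [t _] := pzP x; apply: leq_trans; rewrite leq_addl.
have bound (s : seq A) : tree_size (enc s) <= ql n ->
    tree_size (enc (para (h x) (z x) s)) <= qz n + size s * g (n + ql n + 1).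
  elim: s => [|a s IH] sle; first by rewrite addn0.
  apply: leq_trans (hg _ _ _ _) _.
  have sle' : tree_size (enc s) <= ql n by rewrite tree_size_cons in sle; lia.
  have : g (tree_size (enc (x, a :: s))) <= g (n + ql n + 1).
    apply: gP.1; have -> : tree_size (enc (x, a :: s)) = (n + tree_size (enc (a :: s))).+1 by [].
    by lia.
  move=> gle; have := IH sle'; rewrite [size (a :: s)]/= mulSn => IHs.
  rewrite addnCA addnC; exact: leq_add.
have slen (s : seq A) : tree_size (enc s) <= ql n -> size s <= ql n.
  exact: leq_trans (size_enc _).
apply: (@leq_trans (\sum_(i < (size (l x)).+1) (qz n + ql n * g (n + ql n + 1)))).
  apply: leq_sum => i _.
  have dl : tree_size (enc (drop i (l x))) <= ql n by apply: leq_trans (tree_size_drop _ _) lsize.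
  by apply: leq_trans (bound _ dl) _; rewrite leq_add2l leq_mul2r slen ?orbT.
by rewrite sum_nat_const card_ord leq_mul2r ltnS slen ?orbT.
Qed.

End PolytimePara.

Section BasicOperations.
Context {X A B C : Type} `{encodable X} `{encodable A} `{encodable B} `{encodable C}.

Lemma polytime_id : polytime (fun x : X => x).
Proof. exact: (polytime_expr (e := EVar 0)). Qed.

Lemma polytime_const (b : B) : polytime (fun _ : X => b).
Proof.
pose fix quote t := if t is Defs.Cons t1 t2 then ECons (quote t1) (quote t2) else ENil.
apply: (polytime_expr (e := quote (enc b))) => a.
by elim: (enc b) => //= t1 -> t2 ->.
Qed.

Lemma polytime_fst (f : X -> A * B) : polytime f -> polytime (fun x => (f x).1).
Proof. by move=> fP; apply: polytime_comp fP; apply: (polytime_expr (e := EHd (EVar 0))). Qed.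

Lemma polytime_snd (f : X -> A * B) : polytime f -> polytime (fun x => (f x).2).
Proof. by move=> fP; apply: polytime_comp fP; apply: (polytime_expr (e := ETl (EVar 0))). Qed.

Lemma polytime_comp2 (g : A -> B -> C) (f1 : X -> A) (f2 : X -> B) :
  polytime (fun p : A * B => g p.1 p.2) -> polytime f1 -> polytime f2 ->
  polytime (fun x => g (f1 x) (f2 x)).
Proof.
move=> gP f1P f2P.
exact: (@polytime_comp X (A * B) C _ _ _ (fun p => g p.1 p.2) (fun x => (f1 x, f2 x)) gP
  (polytime_pair f1P f2P)).
Qed.

Lemma polytime_cons (f : X -> A) (g : X -> seq A) :
  polytime f -> polytime g -> polytime (fun x => f x :: g x).
Proof.
move=> fP gP; apply: eq_polytime_for (polytime_pair fP gP) => //.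
Qed.

(** The [If] of the language tests the code of [l x] directly, and a nonempty list is already the
    code of its head and tail as a pair. *)
Lemma polytime_match (l : X -> seq A) (z : X -> B) (h : X -> A -> seq A -> B) :
  polytime l -> polytime z -> polytime (fun y : X * (A * seq A) => h y.1 y.2.1 y.2.2) ->
  polytime (fun x => if l x is a :: s then h x a s else z x).
Proof.
move=> [p [q [qP pP]]] [p1 [q1 [q1P p1P]]] [p2 [q2 [q2P p2P]]].
exists (Seq (Call 1 p (EVar 0))
  (If (EVar 1) (Call 0 p2 (ECons (EVar 0) (EVar 1))) (Call 0 p1 (EVar 0)))).
exists (fun s => q s + q1 s + q2 (s + q s + 1) + 20); split; first by polynomially_bounded.
move=> x; have [t [s st s0] tle] := pP x.
have [u1 [s1 su1 s10] u1le] := p1P x.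
case lx: (l x) s0 tle => [|a l'] s0 tle.
  exists ((1 + t).+1 + (1 + (1 + u1).+1).+1).+1; last by lia.
  exists (upd (upd (upd empty_store 0 (enc x)) 1 (s 0)) 0 (s1 0)); last by [].
  apply: ExecSeq; first exact: (@ExecCall 1 p (EVar 0) _ _ _ st).
  rewrite s0; apply: (@ExecIfFalse (EVar 1)) => //.
  exact: (@ExecCall 0 p1 (EVar 0) _ _ _ su1).
have [u2 [s2 su2 s20] u2le] := p2P (x, (a, l')).
exists ((1 + t).+1 + (1 + (3 + u2).+1).+1).+1.
  exists (upd (upd (upd empty_store 0 (enc x)) 1 (s 0)) 0 (s2 0)); last by [].
  apply: ExecSeq; first exact: (@ExecCall 1 p (EVar 0) _ _ _ st).
  rewrite s0; apply: (@ExecIfTrue (EVar 1)) => //.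
  exact: (@ExecCall 0 p2 (ECons (EVar 0) (EVar 1)) _ _ _ su2).
have : q2 (tree_size (enc (x, (a, l')))) <= q2 (tree_size (enc x) + q (tree_size (enc x)) + 1).
  apply: q2P.1.
  have -> : tree_size (enc (x, (a, l'))) = (tree_size (enc x) + tree_size (enc (a :: l'))).+1 by [].
  by lia.
by move: u2le; rewrite /=; lia.
Qed.

End BasicOperations.

Section BooleanOperations.
Context {X A : Type} `{encodable X} `{encodable A}.

Lemma polytime_andb (P Q : X -> bool) :
  polytime P -> polytime Q -> polytime (fun x => P x && Q x).
Proof. by move=> PP QP; apply: polytime_if PP QP _; apply: polytime_const. Qed.

Lemma polytime_orb (P Q : X -> bool) :
  polytime P -> polytime Q -> polytime (fun x => P x || Q x).
Proof. by move=> PP QP; apply: polytime_if PP _ QP; apply: polytime_const. Qed.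

Lemma polytime_negb (P : X -> bool) : polytime P -> polytime (fun x => ~~ P x).
Proof. by move=> PP; apply: polytime_if PP _ _; apply: polytime_const. Qed.

Lemma polytime_nilp (l : X -> seq A) : polytime l -> polytime (fun x => nilp (l x)).
Proof.
move=> lP; apply: (eq_polytime_for (f := fun x => if l x is _ :: _ then false else true)).
  by move=> x; case: (l x).
by apply: polytime_match lP _ _; apply: polytime_const.
Qed.

End BooleanOperations.

Ltac polytime_var := repeat first
  [ assumption | apply polytime_id | apply polytime_const | apply polytime_fst
  | apply polytime_snd ].

Section Folds.
Context {X A B : Type} `{encodable X} `{encodable A} `{encodable B}.
Variables (h : X -> A -> seq A -> B -> B) (z : X -> B) (l : X -> seq A).
Hypotheses (zP : polytime z) (lP : polytime l).
Hypothesis hP :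
  polytime (fun y : X * (A * seq A * B) => h y.1 y.2.1.1 y.2.1.2 y.2.2).

Lemma polytime_para_step : polytime (fun y : X * (seq A * B) =>
  if y.2.1 is a :: s then h y.1 a s y.2.2 else y.2.2).
Proof.
apply: (polytime_match (h := fun y a s => h y.1 a s y.2.2)); try by polytime_var.
apply: (polytime_comp hP (f := fun y : X * (seq A * B) * (A * seq A) =>
  (y.1.1, (y.2, y.1.2.2)))) => //.
by apply: polytime_pair; [|apply: polytime_pair]; polytime_var.
Qed.

Lemma polytime_para (g : nat -> nat) : polynomially_bounded g ->
  (forall x a s b,
    tree_size (enc (h x a s b)) <= tree_size (enc b) + g (tree_size (enc (x, a :: s)))) ->
  polytime (fun x => para (h x) (z x) (l x)).
Proof. by move=> gP hg; apply: polytime_additive_growth gP hg polytime_para_step zP lP. Qed.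

End Folds.

(** * Operations on lists, as folds *)

Section ListOperations.
Context {X A B : Type} `{encodable X} `{encodable A} `{encodable B}.
Implicit Types l : X -> seq A.

Lemma polytime_para_bool (P : X -> A -> seq A -> bool -> bool) (z : X -> bool) l :
  polytime z -> polytime l ->
  polytime (fun y : X * (A * seq A * bool) => P y.1 y.2.1.1 y.2.1.2 y.2.2) ->
  polytime (fun x => para (P x) (z x) (l x)).
Proof.
move=> zP lP PP; apply: (polytime_para zP lP PP (polynomially_bounded_const 3)) => x a s b.
by case: (P _ _ _ _); case: b.
Qed.

(** The common shape of filtering, mapping, concatenation, [iota] and [undup]. The test may inspect
    the accumulator but the new element may not, so the size added by a step is bounded in terms of
    [x], [a] and [s]. *)
Lemma polytime_collect (P : X -> A -> seq A -> seq B -> bool) (k : X -> A -> seq A -> B)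
    (z : X -> seq B) l :
  polytime z -> polytime l ->
  polytime (fun y : X * (A * seq A * seq B) => P y.1 y.2.1.1 y.2.1.2 y.2.2) ->
  polytime (fun y : X * (A * seq A) => k y.1 y.2.1 y.2.2) ->
  polytime (fun x => para (fun a s b => if P x a s b then k x a s :: b else b) (z x) (l x)).
Proof.
move=> zP lP PP kP; have [p [q [qP pP]]] := kP.
apply: (polytime_para (h := fun x a s b => if P x a s b then k x a s :: b else b) zP lP _
  (g := fun s => q s + 1)); [| by polynomially_bounded |].
  apply: polytime_if => //; last by polytime_var.
  apply: polytime_cons; last by polytime_var.
  apply: (polytime_comp kP (f := fun y : X * (A * seq A * seq B) => (y.1, y.2.1))).
  by apply: polytime_pair; polytime_var.
move=> x a s b; case: ifP => _; last exact: leq_addr.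
have [t _] := pP (x, (a, s)).
have -> : tree_size (enc (x, (a, s))) = tree_size (enc (x, a :: s)) by [].
by rewrite tree_size_cons /=; lia.
Qed.

End ListOperations.

Section ListOperations.
Context {X A B : Type} `{encodable X} `{encodable A} `{encodable B}.
Implicit Types l : X -> seq A.

Lemma polytime_filter (P : X -> A -> bool) l :
  polytime l -> polytime (fun y : X * A => P y.1 y.2) ->
  polytime (fun x => filter (P x) (l x)).
Proof.
move=> lP PP; apply: (eq_polytime_for (f := fun x =>
  para (fun a _ b => if P x a then a :: b else b) [::] (l x))).
  by move=> x; congr enc; elim: (l x) => //= a s <-.
apply: (polytime_collect (P := fun x a _ _ => P x a) (k := fun _ a _ => a)); polytime_var.
apply: (polytime_comp PP (f := fun y : X * (A * seq A * seq A) => (y.1, y.2.1.1))).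
by apply: polytime_pair; polytime_var.
Qed.

Lemma polytime_map (f : X -> A -> B) l :
  polytime l -> polytime (fun y : X * A => f y.1 y.2) ->
  polytime (fun x => map (f x) (l x)).
Proof.
move=> lP fP; apply: (eq_polytime_for (f := fun x =>
  para (fun a _ b => if true then f x a :: b else b) [::] (l x))).
  by move=> x; congr enc; elim: (l x) => //= a s <-.
apply: (polytime_collect (P := fun _ _ _ _ => true)) => //; polytime_var.
apply: (polytime_comp fP (f := fun y : X * (A * seq A) => (y.1, y.2.1))).
by apply: polytime_pair; polytime_var.
Qed.

Lemma polytime_cat l l' : polytime l -> polytime l' -> polytime (fun x => l x ++ l' x).
Proof.
move=> lP l'P; apply: (eq_polytime_for (f := fun x =>
  para (fun a _ b => if true then a :: b else b) (l' x) (l x))).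
  by move=> x; congr enc; elim: (l x) => //= a s <-.
by apply: (polytime_collect (P := fun _ _ _ _ => true)) => //; polytime_var.
Qed.

Lemma polytime_has (P : X -> A -> bool) l :
  polytime l -> polytime (fun y : X * A => P y.1 y.2) ->
  polytime (fun x => has (P x) (l x)).
Proof.
move=> lP PP; apply: (eq_polytime_for (f := fun x =>
  para (fun a _ b => P x a || b) false (l x))).
  by move=> x; congr enc; elim: (l x) => //= a s <-.
apply: (polytime_para_bool (P := fun x a _ b => P x a || b)); polytime_var.
apply: polytime_orb; last by polytime_var.
apply: (polytime_comp PP (f := fun y : X * (A * seq A * bool) => (y.1, y.2.1.1))).
by apply: polytime_pair; polytime_var.
Qed.

End ListOperations.

Lemma polytime_all X A `{encodable X} `{encodable A} (P : X -> A -> bool) (l : X -> seq A) :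
  polytime l -> polytime (fun y : X * A => P y.1 y.2) ->
  polytime (fun x => all (P x) (l x)).
Proof.
move=> lP PP; apply: (eq_polytime_for (f := fun x => ~~ has (fun a => ~~ P x a) (l x))).
  by move=> x; rewrite has_predC negbK.
by apply: polytime_negb; apply: polytime_has => //; apply: polytime_negb.
Qed.

Lemma polytime_size X A `{encodable X} `{encodable A} (l : X -> seq A) :
  polytime l -> polytime (fun x => size (l x)).
Proof.
move=> lP; apply: (eq_polytime_for (f := fun x => map (fun=> false) (l x))).
  by move=> x; elim: (l x) => //= a s IH; exact: (congr1 (Defs.Cons Nil) IH).
by apply: polytime_map => //; polytime_var.
Qed.

Lemma tree_size_cat A `{encodable A} (s1 s2 : seq A) :
  tree_size (enc (s1 ++ s2)) <= tree_size (enc s1) + tree_size (enc s2).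
Proof.
elim: s1 => [|a s1 IH]; first exact: leq_addl.
by rewrite cat_cons !tree_size_cons addSn ltnS -addnA leq_add2l.
Qed.

Lemma polytime_flatten X A `{encodable X} `{encodable A} (l : X -> seq (seq A)) :
  polytime l -> polytime (fun x => flatten (l x)).
Proof.
move=> lP; apply: (eq_polytime_for (f := fun x => para (fun a _ b => a ++ b) [::] (l x))).
  by move=> x; congr enc; elim: (l x) => //= a s <-.
apply: polytime_para polynomially_bounded_id _ => //; first by polytime_var.
  by apply: polytime_cat; polytime_var.
move=> x a s b; apply: leq_trans (tree_size_cat _ _) _; rewrite addnC leq_add2l.
have -> : tree_size (enc (x, a :: s)) =
  (tree_size (enc x) + (tree_size (enc a) + tree_size (enc s)).+1).+1 by [].
by lia.
Qed.

Lemma polytime_rev X A `{encodable X} `{encodable A} (l : X -> seq A) :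
  polytime l -> polytime (fun x => rev (l x)).
Proof.
move=> lP; apply: (eq_polytime_for (f := fun x => para (fun a _ b => b ++ [:: a]) [::] (l x))).
  by move=> x; congr enc; elim: (l x) => //= a s ->; rewrite rev_cons cats1.
apply: (polytime_para _ lP _ (g := fun s => s + 2)); first by polytime_var.
- by apply: polytime_cat; [|apply: polytime_cons]; polytime_var.
- by polynomially_bounded.
move=> x a s b; apply: leq_trans (tree_size_cat _ _) _; rewrite leq_add2l.
have -> : tree_size (enc (x, a :: s)) =
  (tree_size (enc x) + (tree_size (enc a) + tree_size (enc s)).+1).+1 by [].
by rewrite tree_size_cons [tree_size (enc [::])]/=; lia.
Qed.

(** * Arithmetic on unary numbers and access to positions *)

Section NatOperations.
Context {X A : Type} `{encodable X} `{encodable A}.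
Implicit Types f g : X -> nat.

Lemma polytime_nseq f : polytime f -> polytime (fun x => nseq (f x) false).
Proof.
move=> fP; apply: eq_polytime_for fP => x; elim: (f x) => //= n IH.
exact: (congr1 (Defs.Cons Nil) IH).
Qed.

Lemma polytime_succ f : polytime f -> polytime (fun x => (f x).+1).
Proof.
by move=> fP; apply: polytime_comp fP; apply: (polytime_expr (e := ECons ENil (EVar 0))).
Qed.

Lemma polytime_pred f : polytime f -> polytime (fun x => (f x).-1).
Proof.
move=> fP; apply: polytime_comp fP; apply: (polytime_expr (e := ETl (EVar 0))).
by case.
Qed.

Lemma polytime_behead (l : X -> seq A) : polytime l -> polytime (fun x => behead (l x)).
Proof.
move=> fP; apply: polytime_comp fP; apply: (polytime_expr (e := ETl (EVar 0))).
by case.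
Qed.

Lemma polytime_iota f : polytime f -> polytime (fun x => iota 0 (f x)).
Proof.
(* From the head on, the lengths of the remaining lists are n - 1, ..., 0, so the order must be
   reversed. *)
move=> fP; apply: (eq_polytime_for (f := fun x => rev
  (para (fun _ s b => if true then size s :: b else b) [::] (nseq (f x) false)))).
  move=> x; congr enc; elim: (f x) => // n IH.
  by rewrite -[in RHS]addn1 iotaD /= rev_cons IH size_nseq cats1.
apply: polytime_rev; apply: (polytime_collect (P := fun _ _ _ _ => true)).
- by polytime_var.
- exact: polytime_nseq.
- by polytime_var.
by apply: polytime_size; polytime_var.
Qed.

End NatOperations.

Section Comparisons.
Context {X : Type} `{encodable X}.
Implicit Types f g : X -> nat.

Lemma polytime_subn f g : polytime f -> polytime g -> polytime (fun x => f x - g x).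
Proof.
move=> fP gP; apply: (eq_polytime_for (f := fun x =>
  para (fun _ _ b => b.-1) (f x) (nseq (g x) false))).
  by move=> x; congr enc; elim: (g x) => [|n /= ->]; rewrite ?subn0 // subnS.
apply: polytime_para (polynomially_bounded_const 0) _ => //.
- exact: polytime_nseq.
- by apply: polytime_pred; polytime_var.
by move=> _ _ _ [|b] //=; rewrite addn0; apply: leqW.
Qed.

Lemma polytime_leq f g : polytime f -> polytime g -> polytime (fun x => f x <= g x).
Proof.
move=> fP gP; apply: (eq_polytime_for (f := fun x => nilp (nseq (f x - g x) false))).
  by move=> x; rewrite /nilp size_nseq.
by apply: polytime_nilp; apply: polytime_nseq; apply: polytime_subn.
Qed.

(** Repeated [behead] only shrinks the accumulator; on a list that is too short it ends at the empty
    list, where the match returns [x0]. *)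
Lemma polytime_nth A `{encodable A} (x0 : A) (l : X -> seq A) f :
  polytime l -> polytime f -> polytime (fun x => nth x0 (l x) (f x)).
Proof.
move=> lP fP; apply: (eq_polytime_for (f := fun x =>
  if para (fun _ _ b => behead b) (l x) (nseq (f x) false) is a :: _ then a else x0)).
  move=> x; congr enc; transitivity (head x0 (drop (f x) (l x))).
    congr head; elim: (f x) => [|n /= ->]; rewrite ?drop0 //.
    by rewrite -add1n -drop_drop drop1.
  by rewrite -nth0 nth_drop addn0.
apply: (polytime_match (h := fun _ a _ => a)); try by polytime_var.
apply: polytime_para (polynomially_bounded_const 0) _ => //.
- exact: polytime_nseq.
- by apply: polytime_behead; polytime_var.
move=> _ _ _ [|a b] //; rewrite addn0 [behead _]/= tree_size_cons; lia.
Qed.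

End Comparisons.

(** Equality of trees is not a primitive, so every type of elements has to bring its own program for
    [==]. *)
Class polytime_eq (A : eqType) `{encodable A} : Prop :=
  PolytimeEq { polytime_eqP : polytime (fun p : A * A => p.1 == p.2) }.
Arguments polytime_eq A {_}.

#[export] Instance polytime_eq_nat : polytime_eq nat.
Proof.
constructor; apply: (eq_polytime_for (f := fun p : nat * nat => (p.1 <= p.2) && (p.2 <= p.1))).
  by move=> p; rewrite -eqn_leq.
by apply: polytime_andb; apply: polytime_leq; polytime_var.
Qed.

#[export] Instance polytime_eq_prod (A B : eqType) `{polytime_eq A} `{polytime_eq B} :
  polytime_eq (A * B)%type.
Proof.
constructor; apply: (eq_polytime_for (f := fun p : (A * B) * (A * B) =>
  (p.1.1 == p.2.1) && (p.1.2 == p.2.2))).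
  by move=> p.
apply: polytime_andb.
  by apply: (polytime_comp2 (g := fun a b : A => a == b)) polytime_eqP _ _; polytime_var.
by apply: (polytime_comp2 (g := fun a b : B => a == b)) polytime_eqP _ _; polytime_var.
Qed.

(* Comparing position by position avoids a simultaneous recursion on two lists. *)
Lemma polytime_eq_seq (A : eqType) `{polytime_eq A} (x0 : A) : polytime_eq (seq A).
Proof.
constructor; apply: (eq_polytime_for (f := fun p : seq A * seq A =>
  ((size p.1 == size p.2) &&
    all (fun i => nth x0 p.1 i == nth x0 p.2 i) (iota 0 (size p.1))))).
  move=> [s t]; congr enc; apply/andP/eqP => /= [[/eqP st /allP nst]|->].
    by apply: (eq_from_nth (x0 := x0) st) => i il; apply/eqP/nst; rewrite mem_iota.
  by split=> //; apply/allP.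
apply: polytime_andb.
  by apply: (polytime_comp2 (g := fun a b : nat => a == b)) polytime_eqP _ _;
    apply: polytime_size; polytime_var.
apply: polytime_all; first by apply: polytime_iota; apply: polytime_size; polytime_var.
by apply: (polytime_comp2 (g := fun a b : A => a == b)) polytime_eqP _ _;
  apply: polytime_nth; polytime_var.
Qed.

#[export] Instance polytime_eq_seq_nat : polytime_eq (seq nat) := polytime_eq_seq 0.

Section EqTypes.
Context {X : Type} {A : eqType} `{encodable X} `{polytime_eq A}.

Lemma polytime_eqb (f g : X -> A) : polytime f -> polytime g -> polytime (fun x => f x == g x).
Proof. exact: (polytime_comp2 (g := fun a b : A => a == b) polytime_eqP). Qed.

Lemma polytime_mem (f : X -> A) (l : X -> seq A) :
  polytime f -> polytime l -> polytime (fun x => f x \in l x).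
Proof.
move=> fP lP; apply: (eq_polytime_for (f := fun x => has (fun a => f x == a) (l x))).
  by move=> x; rewrite -has_pred1; congr enc; apply: eq_has => a; rewrite /= eq_sym.
apply: polytime_has => //; apply: (polytime_comp2 (g := fun a b : A => a == b)) polytime_eqP _ _;
  last by polytime_var.
by apply: polytime_comp fP _; polytime_var.
Qed.

End EqTypes.

Lemma polytime_undup X (A : eqType) `{encodable X} `{polytime_eq A} (l : X -> seq A) :
  polytime l -> polytime (fun x => undup (l x)).
Proof.
move=> lP; apply: (eq_polytime_for (f := fun x =>
  para (fun a s b => if a \notin s then a :: b else b) [::] (l x))).
  by move=> x; congr enc; elim: (l x) => //= a s ->; case: (a \in s).
apply: (polytime_collect (P := fun _ a s _ => a \notin s) (k := fun _ a _ => a)); polytime_var.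
by apply: polytime_negb; apply: polytime_mem => //; polytime_var.
Qed.

(** * The algorithm on lists of numbers *)

Ltac polytime_step :=
  lazymatch goal with
  | |- polytime_eq _ =>
      first [exact polytime_eq_nat | exact polytime_eq_seq_nat | apply polytime_eq_prod]
  | |- polytime_for _ (fun x => x) => apply polytime_id
  | H : ?P |- ?P => exact H
  | |- polytime_for _ fst => apply (polytime_fst polytime_id)
  | |- polytime_for _ snd => apply (polytime_snd polytime_id)
  | |- polytime_for _ (fun x => (_, _)) => apply polytime_pair
  | |- polytime_for _ (fun x => fst _) => apply polytime_fst
  | |- polytime_for _ (fun x => snd _) => apply polytime_snd
  | |- polytime_for _ (fun x => ~~ _) => apply polytime_negb
  | |- polytime_for _ (fun x => _ && _) => apply polytime_andb
  | |- polytime_for _ (fun x => _ || _) => apply polytime_orb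
  | |- polytime_for _ (fun x => leq _ _) => apply polytime_leq
  | |- polytime_for _ (fun x => S _) => apply polytime_succ
  | |- polytime_for _ (fun x => _ :: _) => apply polytime_cons
  | |- polytime_for _ (fun x => _ == _) => apply polytime_eqb
  | |- polytime_for _ (fun x => _ \in _) => apply polytime_mem
  | |- polytime_for _ (fun x => undup _) => apply polytime_undup
  | |- polytime_for _ (fun x => iota 0 _) => apply polytime_iota
  | |- polytime_for _ (fun x => size _) => eapply polytime_size
  | |- polytime_for _ (fun x => nth _ _ _) => apply polytime_nth
  | |- polytime_for _ (fun x => _ ++ _) => apply polytime_cat
  | |- polytime_for _ (fun x => flatten _) => apply polytime_flatten
  | |- polytime_for _ (fun x => filter _ _) => apply polytime_filter
  | |- polytime_for _ (fun x => map _ _) => apply polytime_map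
  | |- polytime_for _ (fun x => has _ _) => apply polytime_has
  | H : polytime_for _ ?g |- polytime_for _ (fun y => ?g _) =>
      apply (polytime_comp H)
  end.

Ltac polytime := repeat first [polytime_step | apply polytime_const].

Definition F_list (k : nat) (R : seq (nat * nat)) (l : nat) : seq nat :=
  [seq j <- iota 0 k | (j, l) \notin R].

(** Both components of a pair are increasing lists determined by the class of the target, so targets
    of one class yield equal pairs and [undup] does the merging. *)
Definition node_list (n k : nat) (R : seq (nat * nat)) : seq (seq nat * seq nat) :=
  undup [seq ([seq l' <- iota 0 n | F_list k R l' == F_list k R l], F_list k R l)
        | l <- iota 0 n].

Definition node_data (ns : seq (seq nat * seq nat)) (v : nat) : seq nat * seq nat :=
  nth ([::], [::]) ns v.

Definition list_adjacent (ns : seq (seq nat * seq nat)) (v w : nat) : bool :=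
  (v != w) && has (fun j => j \in (node_data ns w).2) (node_data ns v).2.

Definition edge_list (ns : seq (seq nat * seq nat)) : seq (nat * nat) :=
  flatten [seq [seq (v, w) | w <- [seq w <- iota 0 (size ns) | list_adjacent ns v w]]
          | v <- iota 0 (size ns)].

Definition build_graph (x : nat * (nat * seq (nat * nat))) :=
  let ns := node_list x.1 x.2.1 x.2.2 in (ns, (size ns, edge_list ns)).

Lemma polytime_F_list X `{encodable X} (k : X -> nat) R (l : X -> nat) :
  polytime k -> polytime R -> polytime l -> polytime (fun x => F_list (k x) (R x) (l x)).
Proof. by move=> *; rewrite /F_list; polytime. Qed.

Lemma polytime_node_list X `{encodable X} (n k : X -> nat) R :
  polytime n -> polytime k -> polytime R -> polytime (fun x => node_list (n x) (k x) (R x)).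
Proof.
by move=> *; rewrite /node_list; repeat (polytime; try apply polytime_F_list).
Qed.

Lemma polytime_node_data X `{encodable X} (ns : X -> _) (v : X -> nat) :
  polytime ns -> polytime v -> polytime (fun x => node_data (ns x) (v x)).
Proof. by move=> *; rewrite /node_data; polytime. Qed.

Lemma polytime_list_adjacent X `{encodable X} (ns : X -> _) (v w : X -> nat) :
  polytime ns -> polytime v -> polytime w ->
  polytime (fun x => list_adjacent (ns x) (v x) (w x)).
Proof.
by move=> *; rewrite /list_adjacent; polytime; apply: polytime_node_data; polytime.
Qed.

Lemma polytime_edge_list X `{encodable X} (ns : X -> _) :
  polytime ns -> polytime (fun x => edge_list (ns x)).
Proof.
by move=> *; rewrite /edge_list; repeat (polytime; try apply polytime_list_adjacent).
Qed.

Lemma polytime_build_graph : polytime build_graph.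
Proof.
by rewrite /build_graph; repeat (polytime; try apply polytime_edge_list;
  try apply polytime_node_list).
Qed.

(* Vertex sets are kept sorted, so that [undup] identifies equal sets. *)
Definition extend (m : nat) (V : seq nat) (w : nat) : seq nat :=
  [seq i <- iota 0 m | (i == w) || (i \in V)].

Definition grow (m : nat) (E : seq (nat * nat)) (L : seq (seq nat)) : seq (seq nat) :=
  undup (L ++ flatten [seq [seq extend m V w |
    w <- [seq w <- iota 0 m | has (fun u => (u, w) \in E) V]] | V <- L]).

Definition singletons (m : nat) : seq (seq nat) := [seq [:: i] | i <- iota 0 m].

Definition connected_list (m : nat) (E : seq (nat * nat)) : seq (seq nat) :=
  iter m (grow m E) (singletons m).

Lemma polytime_grow X `{encodable X} (m : X -> nat) E L :
  polytime m -> polytime E -> polytime L -> polytime (fun x => grow (m x) (E x) (L x)).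
Proof. by move=> *; rewrite /grow /extend; polytime. Qed.

(** The additive criterion does not cover [grow], so the measure keeps the sizes of all rounds. The
    iteration is a fold over [x.1] dummies; the suffix left after dropping [i] of them corresponds
    to round [x.1 - i]. *)
Lemma polytime_connected_list :
  polytime_for (fun x : nat * seq (nat * nat) => tree_size (enc x) +
      \sum_(i < x.1.+1) tree_size (enc (iter (x.1 - i) (grow x.1 x.2) (singletons x.1))))
    (fun x => connected_list x.1 x.2).
Proof.
pose h x (_ : bool) (_ : seq bool) L := grow x.1 x.2 L.
pose l (x : nat * seq (nat * nat)) := nseq x.1 false.
have iterE x n : para (h x) (singletons x.1) (nseq n false) =
    iter n (grow x.1 x.2) (singletons x.1).
  by elim: n => //= n ->.
have step : polytime (fun y : nat * seq (nat * nat) * (bool * seq bool * seq (seq nat)) =>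
    grow y.1.1 y.1.2 y.2.2).
  by apply polytime_grow; polytime.
have [||p [q [qP pP]]] := polytime_for_para (z := fun x => singletons x.1) (l := l)
  (polytime_para_step (h := h) step).
- by rewrite /singletons; polytime.
- by apply polytime_nseq; polytime.
exists p, q; split=> // x; have [t] := pP x.
rewrite iterE => r tle; exists t; first exact: r.
apply: leq_trans tle _; apply: qP.1.
rewrite /para_size size_nseq leq_add2l; apply: leq_sum => i _.
by rewrite drop_nseq iterE.
Qed.

Definition variable_list (ns : seq (seq nat * seq nat)) (V : seq nat) : seq nat :=
  undup (flatten [seq (node_data ns v).1 | v <- V]).

Definition resource_list (ns : seq (seq nat * seq nat)) (V : seq nat) : seq nat :=
  undup (flatten [seq (node_data ns v).2 | v <- V]).

Definition constraint_list (x : seq (seq nat * seq nat) * seq (seq nat)) :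
    seq (seq nat * nat) :=
  [seq (variable_list x.1 V, size (resource_list x.1 V)) |
    V <- [seq V <- x.2 | size (resource_list x.1 V) < size (variable_list x.1 V)]].

Lemma polytime_constraint_list : polytime constraint_list.
Proof.
rewrite /constraint_list /variable_list /resource_list.
by repeat (polytime; try apply polytime_node_data).
Qed.

(** * Connected sets of a graph *)

Lemma connect_invariant (T : finType) (r : rel T) (W : {set T}) x y :
  (forall u w, r u w -> u \in W -> w \in W) -> x \in W -> connect r x y -> y \in W.
Proof.
move=> rW xW /connectP[p rp ->]; elim: p x xW rp => //= u p IH x xW /andP[xu up].
exact: IH (rW _ _ xu xW) up.
Qed.

Section ConnectedSets.
Variables (T : finType) (e : rel T).
Hypothesis e_sym : symmetric e.
Implicit Types (u v w : T) (V W : {set T}).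

Let inner V : rel T := [rel u w | [&& u \in V, w \in V & e u w]].

Let inner_sym V : connect_sym (inner V).
Proof. by apply: sym_connect_sym => u w; rewrite /inner /= andbCA e_sym. Qed.

Lemma induces_connectedP V :
  reflect (V != set0 /\ {in V &, forall x y, connect (inner V) x y})
    (induces_connected e V).
Proof.
apply: (iffP andP) => -[V0 VP]; split=> //.
  by move=> x y xV yV; move/forall_inP: VP => /(_ x xV) /forall_inP /(_ y yV).
by apply/forall_inP => x xV; apply/forall_inP => y yV; apply: VP.
Qed.

Lemma induces_connected1 v : induces_connected e [set v].
Proof.
apply/induces_connectedP; split; first by apply/set0Pn; exists v; rewrite inE.
by move=> x y /set1P-> /set1P->; apply: connect0.
Qed.

Lemma induces_connectedU1 V u w :
  induces_connected e V -> u \in V -> e u w -> induces_connected e (w |: V).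
Proof.
move=> /induces_connectedP[_ VP] uV uw; apply/induces_connectedP; split.
  by apply/set0Pn; exists w; rewrite setU11.
have ux x : x \in w |: V -> connect (inner (w |: V)) u x.
  case/setU1P => [->|xV].
    by apply: connect1; rewrite /inner /= !inE eqxx uV uw orbT.
  apply: connect_sub (VP u x uV xV) => a b /= /and3P[aV bV ab]; apply: connect1.
  by rewrite /inner /= !inE aV bV ab !orbT.
by move=> x y xV yV; apply: connect_trans (ux y yV); rewrite inner_sym; apply: ux.
Qed.

(** Otherwise [W] would be closed under the edges inside [V] and contain everything reachable from
    [v], which is all of [V]. *)
Lemma induces_connected_edge V W v : induces_connected e V ->
  v \in W -> W \proper V -> exists u w, [/\ u \in W, w \in V :\: W & e u w].
Proof.
move=> /induces_connectedP[_ VP] vW /properP[WV [x xV xW]].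
have [/existsP[u /existsP[w /and3P[]]]|] :=
    boolP [exists u, exists w, [&& u \in W, w \in V :\: W & e u w]].
  by exists u, w.
move=> /existsPn noe; case/negP: xW.
apply: (connect_invariant _ vW (VP v x (subsetP WV v vW) xV)) => a b /= /and3P[aV bV ab] aW.
apply: contraT => bW; have /existsPn/(_ b) := noe a.
by rewrite aW ab inE bV bW.
Qed.

(** From any vertex of [V], edges leaving the part [W] reached so far enlarge it one vertex at a
    time until it is [V]. This serves both the bound on boundaries and the completeness of the
    enumeration. *)
Lemma induces_connected_ind (P : {set T} -> Prop) :
    (forall v, P [set v]) ->
    (forall V u w, induces_connected e V -> P V -> u \in V -> w \notin V -> e u w ->
      P (w |: V)) ->
  forall V, induces_connected e V -> P V.
Proof.
move=> P1 PU V cV; have /induces_connectedP[/set0Pn[v vV] _] := cV.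
have extend n : forall W, #|V :\: W| = n -> W \subset V -> v \in W ->
    induces_connected e W -> P W -> P V.
  elim: n => [|n IH] W VW WV vW cW PW.
    suff -> : V = W by [].
    by apply/eqP; rewrite eqEsubset WV -setD_eq0 -cards_eq0 VW.
  have /(induces_connected_edge cV vW)[u [w [uW wVW uw]]] : W \proper V.
    by rewrite properE WV -setD_eq0 -cards_eq0 VW.
  have /setDP[wV wW] := wVW.
  apply: (IH (w |: W)).
  - apply/eqP; rewrite -eqSS -VW (cardsD1 w (V :\: W)) wVW add1n eqSS.
    by rewrite setUC -setDDl.
  - by rewrite subUset sub1set wV.
  - by rewrite setU1r.
  - exact: induces_connectedU1 uw.
  exact: PU uw.
apply: (extend #|V :\: [set v]|) => //; rewrite ?sub1set ?set11 //.
exact: induces_connected1.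
Qed.

Definition vdegree v : nat := #|[set w | e v w]|.

Definition boundary V : {set T} := [set w | (w \notin V) && [exists u in V, e u w]].

(* Adding to V a vertex of its boundary removes this vertex from the boundary and
   adds at most all but one of its neighbours: the boundary only grows when the
   vertex has degree at least 3. *)
Lemma card_boundary D V : (forall v, vdegree v <= D) -> induces_connected e V ->
  #|boundary V| <= 2 + D * #|[set v in V | 3 <= vdegree v]|.
Proof.
move=> degD; elim/induces_connected_ind: V / => [v|V u w cV IH uV wV uw].
  have bv : #|boundary [set v]| <= vdegree v.
    apply/subset_leq_card/subsetP => x; rewrite !inE => /andP[_].
    by case/existsP => y /andP[/set1P->].
  (* A first vertex of degree at most 2 is the origin of the constant 2; one of degree at least 3 is
     paid for by [D]. *)
  have [d3|d3] := leqP 3 (vdegree v); last first.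
    by apply: leq_trans bv (leq_trans _ (leq_addr _ _)).
  rewrite (_ : [set x in _ | _] = [set v]) ?cards1 ?muln1; last first.
    by apply/setP => x; rewrite !inE; case: eqP => // ->; rewrite d3.
  by apply: leq_trans bv (leq_trans (degD v) (leq_addl _ _)).
have wb : w \in boundary V by rewrite inE wV; apply/existsP; exists u; rewrite uV.
have sub : boundary (w |: V) \subset (boundary V :\ w) :|: ([set x | e w x] :\ u).
  apply/subsetP => x; rewrite !inE negb_or => /andP[/andP[xw xV]].
  case/existsP => y /andP[/setU1P[->|yV]]; last move=> yx.
    by move=> wx; rewrite wx andbT; apply/orP; right; apply: contraNneq xV => ->.
  by rewrite xw xV /=; apply/orP; left; apply/existsP; exists y; rewrite yV.
(* Two vertices are saved: [w] leaves the boundary, and its neighbour [u] lies in [V] and cannot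
   enter it. *)
have bw : #|boundary (w |: V)| + 2 <= #|boundary V| + vdegree w.
  have uN : u \in [set x | e w x] by rewrite inE e_sym.
  have := leq_trans (subset_leq_card sub) (leq_card_setU _ _).1.
  have := cardsD1 w (boundary V); have := cardsD1 u [set x | e w x].
  by rewrite wb uN /vdegree; lia.
have [d3|d3] := leqP 3 (vdegree w); last first.
  have : #|[set v in V | 2 < vdegree v]| <= #|[set v in w |: V | 2 < vdegree v]|.
    by apply/subset_leq_card/subsetP => x; rewrite !inE => /andP[-> ->]; rewrite orbT.
  by rewrite -(leq_pmul2l (m := D.+1)) // !mulSn; nia.
have -> : [set v in w |: V | 2 < vdegree v] = w |: [set v in V | 2 < vdegree v].
  by apply/setP => x; rewrite !inE; case: eqP => [->|]; rewrite ?d3.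
rewrite cardsU1 inE (negPf wV) /= mulnDr muln1.
by have := degD w; lia.
Qed.

Lemma component_boundary V v : induces_connected e V -> v \in V ->
  V = [set x | connect [rel u w | [&& u \notin boundary V, w \notin boundary V & e u w]] v x].
Proof.
move=> /induces_connectedP[_ VP] vV; apply/setP => x; rewrite inE; apply/idP/idP.
  move=> xV; apply: connect_sub (VP v x vV xV) => a b /= /and3P[aV bV ab].
  by apply: connect1; rewrite /= !inE aV bV ab.
apply: connect_invariant vV => a b /= /and3P[_ bb ab] aV.
apply: contraR bb => bV; rewrite inE bV; apply/existsP; exists a; rewrite aV.
exact: ab.
Qed.

(** A vertex and a boundary determine the set as a component. Storing the boundary in [b] slots,
    each holding a vertex or [None], makes the bound the size of the domain of a map whose image
    contains all connected sets. *)
Lemma card_connected_subgraphs b :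
    (forall V, induces_connected e V -> #|boundary V| <= b) ->
  #|connected_subgraphs setT e| <= #|T| * #|T|.+1 ^ b.
Proof.
move=> bb; pose f (p : T * {ffun 'I_b -> option T}) : {set T} :=
  let S := [set x | [exists i, p.2 i == Some x]] in
  [set x | connect [rel u w | [&& u \notin S, w \notin S & e u w]] p.1 x].
have <- : #|{: T * {ffun 'I_b -> option T}}| = #|T| * #|T|.+1 ^ b.
  by rewrite card_prod card_ffun card_option card_ord.
rewrite -cardsT; apply: leq_trans (leq_imset_card f _).
apply/subset_leq_card/subsetP => V; rewrite inE => /andP[_ cV].
have /induces_connectedP[/set0Pn[v vV] _] := cV.
(* Surplus slots get the default [None]; the hypothesis on [b] leaves a slot for every boundary
   vertex. *)
pose g := [ffun i : 'I_b => nth None (map Some (enum (boundary V))) i].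
have gS : [set x | [exists i, g i == Some x]] = boundary V.
  apply/setP => x; rewrite inE; apply/existsP/idP => [[i]|xV].
    rewrite ffunE => /eqP gi; rewrite -mem_enum -(mem_map (@Some_inj _)) -gi mem_nth //.
    by rewrite ltnNge; apply/negP => il; rewrite nth_default in gi.
  have xl : index x (enum (boundary V)) < size (enum (boundary V)).
    by rewrite index_mem mem_enum.
  have xb : index x (enum (boundary V)) < b.
    by apply: leq_trans xl _; rewrite -cardE; apply: bb.
  by exists (Ordinal xb); rewrite ffunE (nth_map x) //= nth_index // mem_enum.
apply/imsetP; exists (v, g) => //; rewrite /f /= gS.
exact: component_boundary.
Qed.

End ConnectedSets.

(** * Correctness *)

(** Input sets may be listed in any order, so what is read is described by this relation;
    [canonical], in increasing order, is the listing used for the nodes and vertex sets that the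
    programs compute. *)
Definition represents m (s : seq nat) (S : {set 'I_m}) : Prop :=
  [/\ uniq s, all (fun i => i < m) s & forall i : 'I_m, (val i \in s) = (i \in S)].

Lemma rep_seqE A B `{encodable B} (rA : A -> tree -> Prop) (f : A -> B) :
    (forall a x, rA a x <-> x = enc (f a)) ->
  forall s x, rep_seq rA s x <-> x = enc (map f s).
Proof.
move=> rf; elim=> [|a s IH] x //=; split=> [[y [z [-> /rf-> /IH->]]] //|->].
by exists (enc (f a)), (enc (map f s)); split=> //; [apply/rf | apply/IH].
Qed.

Lemma rep_pairE A B C D `{encodable C} `{encodable D} rA rB (f : A -> C) (g : B -> D) :
    (forall a x, rA a x <-> x = enc (f a)) -> (forall b x, rB b x <-> x = enc (g b)) ->
  forall p x, rep_pair rA rB p x <-> x = enc (f p.1, g p.2).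
Proof.
move=> rf rg p x; split=> [[a [b [-> /rf-> /rg->]]] //|->].
by exists (enc (f p.1)), (enc (g p.2)); split=> //; [apply/rf | apply/rg].
Qed.

Lemma rep_natE n x : rep_nat n x <-> x = enc n. Proof. by []. Qed.

Definition pair_val m n (p : 'I_m * 'I_n) : nat * nat := (val p.1, val p.2).

Lemma rep_pair_ordE m n (p : 'I_m * 'I_n) x :
  rep_pair (@rep_ord m) (@rep_ord n) p x <-> x = enc (pair_val p).
Proof. exact: (rep_pairE (f := val) (g := val)). Qed.

Lemma pair_val_inj m n : injective (@pair_val m n).
Proof. by move=> [a b] [c d] [/val_inj -> /val_inj ->]. Qed.

Lemma mem_pair_val m n (s : seq ('I_m * 'I_n)) i j :
  ((val i, val j) \in map (@pair_val m n) s) = ((i, j) \in s).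
Proof. by rewrite -[(val i, val j)]/(pair_val (i, j)) (mem_map (@pair_val_inj m n)). Qed.

Section Represents.
Variable m : nat.
Implicit Types (S : {set 'I_m}) (s : seq nat).

Lemma represents_map S (t : seq 'I_m) : uniq t -> t =i S -> represents (map val t) S.
Proof.
move=> ut tS; split; first by rewrite map_inj_uniq //; apply: val_inj.
  by apply/allP => _ /mapP[i _ ->]; apply: ltn_ord.
by move=> i; rewrite (mem_map val_inj) tS.
Qed.

Lemma represents_sub S s : represents s S ->
  exists t : seq 'I_m, [/\ uniq t, t =i S & s = map val t].
Proof.
move=> [us /allP sm sS]; exists (pmap insub s); split.
- exact: pmap_sub_uniq.
- by move=> i; rewrite mem_pmap_sub sS.
by rewrite (pmap_filter (insubK _)); apply/esym/all_filterP/allP => i /sm im; rewrite /= insubT.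
Qed.

Lemma rep_ordsetE S x : rep_ordset S x <-> exists2 s, represents s S & x = enc s.
Proof.
have rE := rep_seqE (rA := @rep_ord m) (f := val) (fun=> rep_natE _).
split=> [[t [ut tS /rE->]]|[s /represents_sub[t [ut tS ->]] ->]].
  by exists (map val t) => //; apply: represents_map.
by exists t; split=> //; apply/rE.
Qed.

Lemma size_represents S s : represents s S -> size s = #|S|.
Proof.
move=> /represents_sub[t [ut tS ->]]; rewrite size_map -(card_uniqP ut).
exact: eq_card.
Qed.

Definition canonical S : seq nat := [seq val i | i <- enum S].

Lemma represents_canonical S : represents (canonical S) S.
Proof. by apply: represents_map; [apply: enum_uniq | apply: mem_enum]. Qed.

Lemma mem_canonical S (i : 'I_m) : (val i \in canonical S) = (i \in S).
Proof. by have [_ _ ->] := represents_canonical S. Qed.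

Lemma canonical_inj : injective canonical.
Proof. by move=> S S' SS'; apply/setP => i; rewrite -!mem_canonical SS'. Qed.

(** Ordinals are enumerated in increasing order, so every set built by filtering [iota] is in
    canonical form, and equal sets become equal lists. *)
Lemma filter_iotaE (p : pred nat) :
  [seq i <- iota 0 m | p i] = canonical [set i : 'I_m | p i].
Proof.
rewrite -val_enum_ord filter_map enumT; congr map.
by apply: eq_filter => i; rewrite /= inE.
Qed.

End Represents.

(** * Correctness of the intersection graph *)

Section Build.
Variable I : instance.
Local Notation n := (ntargets I).
Local Notation k := (nresources I).
Variable s : seq ('I_k * 'I_n).
Hypothesis sI : s =i cannot_audit I.

Let R := map (@pair_val k n) s.

Lemma F_listE (l : 'I_n) : F_list k R (val l) = canonical (F l).
Proof.
rewrite /F_list filter_iotaE; congr canonical; apply/setP => j.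
by rewrite !inE mem_pair_val sI.
Qed.

Definition node_of (l : 'I_n) : {set 'I_n} := [set l' | F l' == F l].

Definition node_seq : seq {set 'I_n} := undup [seq node_of l | l <- enum 'I_n].

Lemma numbers_node_seq : numbers_nodes node_seq.
Proof.
split; first exact: undup_uniq.
move=> v; rewrite mem_undup; apply/mapP/imsetP => -[l _ ->]; exists l; rewrite ?mem_enum //.
  by apply/setP => l'; rewrite !inE eq_sym.
by apply/setP => l'; rewrite !inE eq_sym.
Qed.

Lemma nodeF_node_of l : nodeF (node_of l) = F l.
Proof.
apply: nodeFE; last by rewrite inE.
by rewrite -numbers_node_seq.2 mem_undup map_f ?mem_enum.
Qed.

Definition node_code (v : {set 'I_n}) : seq nat * seq nat :=
  (canonical v, canonical (nodeF v)).

Lemma node_code_inj : injective node_code.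
Proof. by move=> v w [/canonical_inj]. Qed.

Lemma node_listE : node_list n k R = map node_code node_seq.
Proof.
(* By injectivity of [node_code], removing duplicate codes is the same as removing duplicate
   nodes. *)
rewrite /node_list -(undup_map_inj node_code_inj); congr undup.
rewrite -[X in map _ X]val_enum_ord -!map_comp.
apply: eq_map => l; rewrite /= /node_code nodeF_node_of F_listE; congr pair.
rewrite filter_iotaE; congr canonical; apply/setP => l'; rewrite !inE.
by rewrite F_listE (inj_eq (@canonical_inj _)).
Qed.

Lemma list_adjacentE (ns : seq {set 'I_n}) (v w : 'I_(size ns)) : uniq ns ->
  list_adjacent (map node_code ns) (val v) (val w) = numbered_adjacent ns v w.
Proof.
move=> uns; rewrite /list_adjacent /numbered_adjacent /adjacent nth_uniq //; congr (_ && _).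
rewrite /node_data !(nth_map set0) //=; set B := nodeF _; set A := nodeF _.
apply/hasP/set0Pn => [[_ /mapP[j jA ->] jB]|[j /setIP[jA jB]]].
  by exists j; rewrite inE -mem_enum jA -mem_canonical.
by exists (val j); rewrite mem_canonical.
Qed.

Definition numbered_edges (ns : seq {set 'I_n}) : seq ('I_(size ns) * 'I_(size ns)) :=
  [seq (v, w) | v <- enum 'I_(size ns),
                w <- [seq w <- enum 'I_(size ns) | numbered_adjacent ns v w]].

Lemma edge_listE ns : uniq ns ->
  edge_list (map node_code ns) = map (@pair_val _ _) (numbered_edges ns).
Proof.
move=> uns; rewrite /edge_list size_map -val_enum_ord map_flatten -!map_comp.
congr flatten; apply: eq_map => v; rewrite /= filter_map -!map_comp; congr map.
by rewrite enumT; apply: eq_filter => w; apply: list_adjacentE.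
Qed.

Lemma mem_numbered_edges ns v w : ((v, w) \in numbered_edges ns) = numbered_adjacent ns v w.
Proof.
apply/allpairsPdep/idP => [[v' [w' [_]]]|vw].
  by rewrite mem_filter => /andP[vw _] [-> ->].
by exists v, w; split; rewrite ?mem_filter -?enumT ?mem_enum ?andbT.
Qed.

Lemma uniq_numbered_edges ns : uniq (numbered_edges ns).
Proof.
apply: allpairs_uniq_dep; first exact: enum_uniq.
  by move=> v _; apply/filter_uniq/enum_uniq.
by move=> [v w] [v' w'] _ _ /= [-> ->].
Qed.

Lemma rep_node_seq : rep_seq (@rep_node I) node_seq (enc (node_list n k R)).
Proof.
rewrite node_listE; elim: node_seq => //= v ns IH.
exists (enc (node_code v)), (enc (map node_code ns)); split=> //.
exists (enc (canonical v)), (enc (canonical (nodeF v))); split=> //; apply/rep_ordsetE.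
  by exists (canonical v); first exact: represents_canonical.
by exists (canonical (nodeF v)); first exact: represents_canonical.
Qed.

Lemma rep_edge_list :
  rep_graph (numbered_adjacent node_seq)
    (enc (size (node_list n k R), edge_list (node_list n k R))).
Proof.
have [uns _] := numbers_node_seq; rewrite node_listE size_map edge_listE //.
exists (enc (size node_seq)), (enc (map (@pair_val _ _) (numbered_edges node_seq))); split=> //.
exists (numbered_edges node_seq); split.
- exact: uniq_numbered_edges.
- by move=> [v w]; rewrite mem_numbered_edges inE.
by apply/(rep_seqE (@rep_pair_ordE _ _)).
Qed.

End Build.

Lemma rep_instanceE (I : instance) x : rep_instance I x ->
  exists s : seq ('I_(nresources I) * 'I_(ntargets I)),
    [/\ uniq s, s =i cannot_audit I &
      x = enc (ntargets I, (nresources I, map (@pair_val _ _) s))].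
Proof.
move=> [_ [_ [-> -> [_ [_ [-> -> [s [us sI /(rep_seqE (@rep_pair_ordE _ _))->]]]]]]]].
by exists s.
Qed.

Lemma rep_graphE m (e : rel 'I_m) x : rep_graph e x ->
  exists s : seq ('I_m * 'I_m), [/\ uniq s, forall u w, ((u, w) \in s) = e u w &
      x = enc (m, map (@pair_val _ _) s)].
Proof.
move=> [_ [_ [-> -> [s [us se /(rep_seqE (@rep_pair_ordE _ _))->]]]]].
by exists s; split=> // u w; rewrite se inE.
Qed.

(** * Correctness of the enumeration of connected sets *)

Section Connected.
Variables (m : nat) (e : rel 'I_m) (s : seq ('I_m * 'I_m)).
Hypotheses (e_sym : symmetric e) (se : forall u w, ((u, w) \in s) = e u w).

Let E := map (@pair_val m m) s.
Let state r := iter r (grow m E) (singletons m).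

Lemma extendE (V : {set 'I_m}) (w : 'I_m) :
  extend m (canonical V) (val w) = canonical (w |: V).
Proof.
rewrite /extend filter_iotaE; congr canonical; apply/setP => i.
by rewrite !inE mem_canonical.
Qed.

Lemma singletonsE : singletons m = [seq canonical [set i] | i <- enum 'I_m].
Proof.
rewrite /singletons -val_enum_ord -map_comp; apply: eq_map => i.
by rewrite /canonical enum_set1.
Qed.

Lemma mem_grow (L : seq (seq nat)) t : t \in grow m E L <->
  t \in L \/ exists2 V, V \in L &
    exists2 w : 'I_m, has (fun u => (u, val w) \in E) V & t = extend m V (val w).
Proof.
rewrite mem_undup mem_cat -val_enum_ord; split=> [/orP[->|/flattenP[_ /mapP[V VL ->]]]|[->|]] //.
- by left.
- case/mapP => i; rewrite mem_filter => /andP[Vi /mapP[w _ iw]] ->; right.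
  by exists V => //; exists w; rewrite -iw.
move=> [V VL [w Vw ->]]; apply/orP; right; apply/flattenP.
by eexists; [apply: map_f VL | apply/map_f; rewrite mem_filter Vw map_f ?mem_enum].
Qed.

Lemma has_neighbour (V : {set 'I_m}) (w : 'I_m) :
  has (fun u => (u, val w) \in E) (canonical V) = [exists u in V, e u w].
Proof.
apply/hasP/existsP => [[_ /mapP[u uV ->]]|[u /andP[uV uw]]].
  by rewrite mem_pair_val se => uw; exists u; rewrite -mem_enum uV.
by exists (val u); rewrite ?mem_canonical // mem_pair_val se.
Qed.

Lemma state_sound r t : t \in state r -> exists2 V, induces_connected e V & t = canonical V.
Proof.
elim: r t => [|r IH] t; rewrite /state.
  rewrite singletonsE => /mapP[i _ ->]; exists [set i] => //; exact: induces_connected1.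
rewrite iterS => /mem_grow[/IH //|[_ /IH[V cV ->] [w]]].
rewrite has_neighbour => /existsP[u /andP[uV uw]] ->.
by exists (w |: V); rewrite ?extendE //; apply: (induces_connectedU1 e_sym cV uV uw).
Qed.

(** Round 0 holds the one-vertex sets and every round allows one more vertex, hence [r.+1]; earlier
    sets persist because [grow] keeps its argument. *)
Lemma state_complete V r : induces_connected e V -> #|V| <= r.+1 -> canonical V \in state r.
Proof.
move=> cV; elim/(induces_connected_ind e_sym): V / cV r => [v|V u w cV IH uV wV uw] r.
  move=> _; elim: r => [|r IH]; last by apply/mem_grow; left.
  by rewrite /state singletonsE; apply/mapP; exists v; rewrite ?mem_enum.
rewrite cardsU1 wV; case: r => [|r] Vr.
  by move: Vr; rewrite (cardsD1 u V) uV.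
apply/mem_grow; right; exists (canonical V); first exact: IH.
exists w; last by rewrite extendE.
by rewrite has_neighbour; apply/existsP; exists u; rewrite uV.
Qed.

Lemma state_uniq r : uniq (state r).
Proof.
case: r => [|r]; last exact: undup_uniq.
rewrite /state singletonsE map_inj_uniq ?enum_uniq // => i j /canonical_inj.
by apply: set1_inj.
Qed.

Definition set_of (t : seq nat) : {set 'I_m} := [set i : 'I_m | val i \in t].

Lemma canonicalK : cancel (@canonical m) set_of.
Proof. by move=> V; apply/setP => i; rewrite inE mem_canonical. Qed.

(** Lifts a round to a duplicate-free sequence of connected sets, whose length is limited by their
    number; this is what keeps every intermediate list small. *)
Lemma state_map r : exists Vs : seq {set 'I_m},
  [/\ uniq Vs, {subset Vs <= connected_subgraphs setT e} & state r = map (@canonical m) Vs].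
Proof.
exists (map set_of (state r)); have stK t : t \in state r -> canonical (set_of t) = t.
  by case/state_sound => V _ ->; rewrite canonicalK.
split; first by rewrite map_inj_in_uniq ?state_uniq // => t t' /stK {2}<- /stK {2}<- ->.
  by move=> _ /mapP[t /state_sound[V cV ->] ->]; rewrite canonicalK inE subsetT.
by rewrite -map_comp -[LHS]map_id; apply/eq_in_map => t /stK.
Qed.

Lemma rep_connected_list :
  rep_finset (@rep_ordset m) (connected_subgraphs setT e) (enc (connected_list m E)).
Proof.
have [Vs [uVs Vsc sE]] := state_map m; exists Vs; split=> //.
  move=> V; apply/idP/idP => [/Vsc //|Vc].
  have cV : induces_connected e V by move: Vc; rewrite !inE => /andP[].
  rewrite -(mem_map (@canonical_inj m)) -sE state_complete // leqW //.
  by rewrite -[X in _ <= X]card_ord max_card.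
rewrite /connected_list -/(state m) sE; elim: Vs {uVs Vsc sE} => //= V Vs IH.
exists (enc (canonical V)), (enc (map (@canonical m) Vs)); split=> //.
by apply/rep_ordsetE; exists (canonical V); first exact: represents_canonical.
Qed.

(** A set has at most [m] vertices, each with a unary code smaller than [2 * m]; the rest of the
    constants pays for list nodes. The bound is uniform in [r]. *)
Lemma tree_size_state r :
  tree_size (enc (state r)) <= (#|connected_subgraphs setT e| * (2 * m * m + 2 * m + 3)).+1.
Proof.
have [Vs [uVs Vsc ->]] := state_map r.
have size_V (V : {set 'I_m}) : tree_size (enc (canonical V)) <= m * (2 * m + 2) + 1.
  apply: (@leq_trans (#|V| * (2 * m + 2) + 1)); last first.
    by rewrite leq_add2r leq_mul2r -[X in _ <= X]card_ord max_card orbT.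
  rewrite /canonical cardE; elim: (enum V) => // i t IH.
  have im : val i < m := ltn_ord i.
  rewrite map_cons tree_size_cons tree_size_nat -[size (i :: t)]/(size t).+1 mulSn.
  lia.
have : size Vs <= #|connected_subgraphs setT e|.
  by rewrite -(card_uniqP uVs); apply/subset_leq_card/subsetP.
elim: Vs #|_| {uVs Vsc} => [|V Vs IH] // [|M] // VsM.
by have := IH M VsM; have := size_V V; rewrite map_cons tree_size_cons mulSn; lia.
Qed.

End Connected.

(** Paths are not transported; by [connect_invariant] it is enough that the image, respectively the
    preimage, under [f] of the reachable vertices is closed under edges. *)
Lemma induces_connected_imset (T T' : finType) (e : rel T) (e' : rel T') (f : T -> T')
    (V : {set T}) :
    injective f -> (forall u w, e u w = e' (f u) (f w)) ->
  induces_connected e' (f @: V) = induces_connected e V.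
Proof.
move=> f_inj ef.
apply/induces_connectedP/induces_connectedP => -[V0 VP]; split.
- by apply: contraNneq V0 => ->; rewrite imset0.
- move=> x y xV yV.
  pose W := f @: [set z | connect [rel u w | [&& u \in V, w \in V & e u w]] x z].
  have /imsetP[z zx /f_inj ->] : f y \in W.
    apply: (connect_invariant _ _ (VP _ _ (imset_f f xV) (imset_f f yV))).
      move=> _ _ /= /and3P[/imsetP[u uV ->] /imsetP[w wV ->] uw].
      rewrite !(mem_imset _ _ f_inj) !inE => xu; apply: connect_trans xu (connect1 _).
      by rewrite /= uV wV ef.
    by rewrite mem_imset // inE connect0.
  by rewrite inE in zx.
- by apply: contraNneq V0 => fV; rewrite -(imset_eq0 f) fV.
move=> _ _ /imsetP[x xV ->] /imsetP[y yV ->].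
pose W := [set z | connect [rel u w | [&& u \in f @: V, w \in f @: V & e' u w]] (f x) (f z)].
have : y \in W; last by rewrite inE.
apply: (connect_invariant _ _ (VP _ _ xV yV)); last by rewrite inE connect0.
move=> u w /= /and3P[uV wV uw]; rewrite !inE => xu; apply: connect_trans xu (connect1 _).
by rewrite /= !imset_f // -ef.
Qed.

(** * Correctness of the collected constraints *)

Section Collect.
Variable I : instance.
Local Notation n := (ntargets I).
Local Notation k := (nresources I).
Variable ns : seq {set 'I_n}.
Hypothesis nsP : numbers_nodes ns.

Definition numbered_set (V : {set 'I_(size ns)}) : {set {set 'I_n}} :=
  [set nth set0 ns (val i) | i in V].

Lemma nth_ns_inj : injective (fun i : 'I_(size ns) => nth set0 ns (val i)).
Proof.
by move=> i j /eqP; rewrite nth_uniq ?nsP.1 ?ltn_ord // => /eqP /val_inj.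
Qed.

Lemma adjacent_sym : symmetric (@adjacent I).
Proof. by move=> v w; rewrite /adjacent eq_sym setIC. Qed.

Lemma numbered_adjacent_sym : symmetric (numbered_adjacent ns).
Proof. by move=> v w; apply: adjacent_sym. Qed.

Lemma numbered_set_inj : injective numbered_set.
Proof. exact: imset_inj nth_ns_inj. Qed.

Lemma numbered_set_nodes V : numbered_set V \subset nodes I.
Proof.
by apply/subsetP => _ /imsetP[i _ ->]; rewrite -nsP.2 mem_nth ?ltn_ord.
Qed.

Lemma numbered_connected (Ss : seq {set 'I_(size ns)}) :
    Ss =i connected_subgraphs setT (numbered_adjacent ns) ->
  map numbered_set Ss =i connected_subgraphs (nodes I) (@adjacent I).
Proof.
have cE V : induces_connected (@adjacent I) (numbered_set V) =
    induces_connected (numbered_adjacent ns) V.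
  exact: induces_connected_imset nth_ns_inj _.
move=> SsE W; rewrite inE; apply/mapP/andP => [[V + ->]|[WN cW]].
  by rewrite SsE inE cE numbered_set_nodes => /andP[].
have WE : W = numbered_set [set i : 'I_(size ns) | nth set0 ns i \in W].
  apply/setP => v; apply/idP/imsetP => [vW|[i + ->]]; last by rewrite inE.
  have vns : v \in ns by rewrite nsP.2 (subsetP WN).
  have vi : index v ns < size ns by rewrite index_mem.
  by exists (Ordinal vi); rewrite ?inE /= nth_index.
by exists [set i : 'I_(size ns) | nth set0 ns i \in W]; rewrite // SsE inE subsetT -cE -WE.
Qed.

(** The nodes are the nonempty blocks of a partition, so a union of nodes determines which ones were
    united. Distinct subgraphs thus give distinct constraints, and the output is duplicate-free
    without comparing constraints. *)
Lemma variables_inj :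
  {in [pred W : {set {set 'I_n}} | W \subset nodes I] &, injective (@variables I)}.
Proof.
have tN : trivIset (nodes I) by have /and3P[] := preim_partitionP (@F I) setT.
have n0 : set0 \notin nodes I by have /and3P[] := preim_partitionP (@F I) setT.
suff sub (W W' : {set {set 'I_n}}) : W \subset nodes I -> W' \subset nodes I ->
    variables W = variables W' -> W \subset W'.
  move=> W W' /[!inE] WN W'N WW'; apply/eqP; rewrite eqEsubset.
  by rewrite (sub W W' WN W'N WW') (sub W' W W'N WN (esym WW')).
move=> WN W'N WW'; apply/subsetP => v vW; have vN := subsetP WN v vW.
have /set0Pn[l lv] : v != set0 by apply: contraNneq n0 => <-.
have : l \in variables W' by rewrite -WW'; apply/bigcupP; exists v.
case/bigcupP => w wW' lw; suff -> : v = w by [].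
apply/eqP; apply: contraT => vw; have /trivIsetP/(_ v w vN (subsetP W'N w wW') vw) := tN.
by move/pred0P/(_ l); rewrite /= lv; rewrite /PV in lw; rewrite lw.
Qed.

Variable nl : seq (seq nat * seq nat).
Hypothesis nlP : forall i, i < size ns ->
  represents (node_data nl i).1 (nth set0 ns i) /\
  represents (node_data nl i).2 (nodeF (nth set0 ns i)).

(** Covers both unions: variables with [h := id], resources with [h := nodeF]. The resources of
    adjacent nodes overlap, and [undup] makes the length equal to [kappa]. *)
Lemma represents_undup_flatten p (g : nat -> seq nat) (h : {set 'I_n} -> {set 'I_p}) t V :
    (forall i, i < size ns -> represents (g i) (h (nth set0 ns i))) -> represents t V ->
  represents (undup (flatten [seq g v | v <- t])) (\bigcup_(v in numbered_set V) h v).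
Proof.
move=> gh /represents_sub[t' [ut' t'V ->]]; split; first exact: undup_uniq.
  apply/allP => j; rewrite mem_undup => /flattenP[_ /mapP[_ /mapP[i _ ->] ->]].
  by have [_ /allP gp _] := gh i (ltn_ord i); apply: gp.
move=> j; rewrite mem_undup; apply/flattenP/bigcupP.
  case=> _ /mapP[_ /mapP[i it' ->] ->] jg; exists (nth set0 ns i).
    by apply/imsetP; exists i; rewrite // -t'V.
  by have [_ _ <-] := gh i (ltn_ord i).
case=> _ /imsetP[i iV ->] jh; exists (g i).
  by apply/map_f/map_f; rewrite t'V.
by have [_ _ ->] := gh i (ltn_ord i).
Qed.

Lemma represents_variable_list t V : represents t V ->
  represents (variable_list nl t) (variables (numbered_set V)).
Proof.
by apply: (represents_undup_flatten (h := id)) => i /nlP[].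
Qed.

Lemma size_resource_list t V : represents t V ->
  size (resource_list nl t) = kappa (numbered_set V).
Proof.
move=> tV; apply: size_represents.
by apply: (represents_undup_flatten (h := @nodeF I)) tV => i /nlP[].
Qed.

Definition constraint_seq (Ss : seq {set 'I_(size ns)}) : seq ({set 'I_n} * nat) :=
  [seq (variables V, kappa V) | V <- [seq numbered_set V | V <- Ss] &
    kappa V < #|variables V|].

Lemma rep_constraint_list Ss b : rep_seq (@rep_ordset (size ns)) Ss b ->
  exists2 Vs, b = enc Vs &
    rep_seq (rep_pair (@rep_ordset _) rep_nat) (constraint_seq Ss)
      (enc (constraint_list (nl, Vs))).
Proof.
elim: Ss b => [|S Ss IH] b /=; first by move=> ->; exists [::].
move=> [y [z [-> /rep_ordsetE[t tS ->] /IH[Vs -> VsP]]]]; exists (t :: Vs) => //.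
rewrite /constraint_list /constraint_seq /= (size_resource_list tS).
have vS := represents_variable_list tS; rewrite (size_represents vS).
case: ifP => //= _.
eexists _, _; split; [reflexivity| | exact: VsP].
eexists _, _; split; [reflexivity| |].
  by apply/rep_ordsetE; exists (variable_list nl t).
by rewrite /= (size_resource_list tS).
Qed.

Lemma rep_constraint_seq (Ss : seq {set 'I_(size ns)}) x : uniq Ss ->
    Ss =i connected_subgraphs setT (numbered_adjacent ns) ->
    rep_seq (rep_pair (@rep_ordset _) rep_nat) (constraint_seq Ss) x ->
  rep_constraints I x.
Proof.
move=> uSs SsE Cx; exists (constraint_seq Ss); split=> //.
  rewrite map_inj_in_uniq; last first.
    move=> V W; rewrite !mem_filter !(numbered_connected SsE) !inE.
    move=> /andP[_ /andP[VN _]] /andP[_ /andP[WN _]] [vVW _].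
    exact: variables_inj VN WN vVW.

  by rewrite filter_uniq // map_inj_uniq //; apply: numbered_set_inj.
move=> c; apply/mapP/mapP => -[V]; rewrite mem_filter => /andP[VP VE] ->; exists V => //.
  by rewrite mem_filter VP mem_enum -(numbered_connected SsE).
by rewrite mem_filter VP (numbered_connected SsE) -mem_enum.
Qed.

End Collect.

Lemma rep_nodeE (I : instance) (ns : seq {set 'I_(ntargets I)}) a :
    rep_seq (@rep_node I) ns a ->
  exists2 nl, a = enc nl & forall i, i < size ns ->
    represents (node_data nl i).1 (nth set0 ns i) /\
    represents (node_data nl i).2 (nodeF (nth set0 ns i)).
Proof.
elim: ns a => [|v ns IH] a /=; first by move=> ->; exists [::].
move=> [_ [z [-> [_ [_ [-> /rep_ordsetE[s sv ->] /rep_ordsetE[t tv ->]]]] /IH[nl -> nlP]]]].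
by exists ((s, t) :: nl) => // -[|i] //=; apply: nlP.
Qed.

(** * Running time *)

Definition connected_count (I : instance) : nat :=
  #|connected_subgraphs setT (numbered_adjacent (node_seq I))|.

Lemma size_node_seq I : size (node_seq I) = #|nodes I|.
Proof.
have [uns nsE] := numbers_node_seq I.
by rewrite -(card_uniqP uns); apply: eq_card.
Qed.

Lemma card_nodes I : #|nodes I| <= ntargets I.
Proof.
rewrite -size_node_seq; apply: leq_trans (size_undup _) _.
by rewrite size_map size_enum_ord.
Qed.

Lemma connected_count_exp I : connected_count I <= 2 ^ #|nodes I|.
Proof.
apply: leq_trans (max_card _) _.
by rewrite -size_node_seq -cardsT -powersetT card_powerset cardsT card_ord.
Qed.

Section Degrees.
Variable I : instance.
Let ns := node_seq I.
Let nsP := numbers_node_seq I.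

Lemma vdegree_degree (i : 'I_(size ns)) :
  vdegree (numbered_adjacent ns) i <= degree (nth set0 ns i).
Proof.
rewrite /vdegree -(card_imset _ (nth_ns_inj nsP)).
apply/subset_leq_card/subsetP => _ /imsetP[j ij ->].
by rewrite inE -nsP.2 mem_nth //=; rewrite inE in ij.
Qed.

Lemma connected_count_degree D h :
    max_degree I <= D -> #|[set v in nodes I | 3 <= degree v]| <= h ->
  connected_count I <= #|nodes I| * #|nodes I|.+1 ^ (2 + D * h).
Proof.
move=> degD branch; rewrite -size_node_seq -[size _]card_ord.
have e_sym := @numbered_adjacent_sym I ns.
have nodeN (i : 'I_(size ns)) : nth set0 ns i \in nodes I by rewrite -nsP.2 mem_nth.
apply: (card_connected_subgraphs (b := 2 + D * h)) => V cV.
apply: leq_trans (card_boundary (D := D) e_sym _ cV) _.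
  move=> i; apply: leq_trans (vdegree_degree i) (leq_trans _ degD).
  exact: (leq_bigmax_cond (F := @degree I) _ (nodeN i)).
rewrite leq_add2l leq_mul2l -(card_imset _ (nth_ns_inj nsP)).
apply/orP; right; apply: leq_trans branch.
apply/subset_leq_card/subsetP => _ /imsetP[i + ->].
by rewrite !inE nodeN => /andP[_ /leq_trans]; apply; apply: vdegree_degree.
Qed.

End Degrees.

(** Being duplicate-free limits the list to [a * b] pairs; this makes every admissible input tree
    polynomial in n and k. *)
Lemma tree_size_pairs a b (s : seq ('I_a * 'I_b)) : uniq s ->
  tree_size (enc (map (@pair_val a b) s)) <= a * b * (2 * a + 2 * b + 4) + 1.
Proof.
move=> us; apply: (@leq_trans (size s * (2 * a + 2 * b + 4) + 1)).
  elim: s {us} => // -[i j] s IH; rewrite map_cons tree_size_cons.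
  have -> : tree_size (enc (pair_val (i, j))) =
    (tree_size (enc (val i)) + tree_size (enc (val j))).+1 by [].
  rewrite !tree_size_nat -[size (_ :: s)]/(size s).+1 mulSn.
  by have : val i < a := ltn_ord i; have : val j < b := ltn_ord j; lia.
rewrite leq_add2r leq_mul2r -(card_uniqP us); apply/orP; right.
by apply: leq_trans (max_card _) _; rewrite card_prod !card_ord.
Qed.

Section Programs.
Variables (build connectedsubgraphs collect : com) (qb qc ql : nat -> nat).
Hypotheses (qbP : polynomially_bounded qb) (qcP : polynomially_bounded qc)
  (qlP : polynomially_bounded ql).
Hypothesis buildP : forall a, exists2 t,
  run build (enc a) (enc (build_graph a)) t &
  t + tree_size (enc (build_graph a)) <= qb (tree_size (enc a)).
Hypothesis connectedP : forall a : nat * seq (nat * nat), exists2 t,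
  run connectedsubgraphs (enc a) (enc (connected_list a.1 a.2)) t &
  t + tree_size (enc (connected_list a.1 a.2)) <= qc (tree_size (enc a) +
    \sum_(i < a.1.+1) tree_size (enc (iter (a.1 - i) (grow a.1 a.2) (singletons a.1)))).
Hypothesis collectP : forall a, exists2 t,
  run collect (enc a) (enc (constraint_list a)) t &
  t + tree_size (enc (constraint_list a)) <= ql (tree_size (enc a)).

Lemma build_correct : builds_intersection_graph build.
Proof.
move=> I x /rep_instanceE[s [us sI ->]].
have [t r _] := buildP (ntargets I, (nresources I, map (@pair_val _ _) s)).
exists (node_seq I); do 2 eexists; exists t; split; first exact: r.
- exact: numbers_node_seq.
- exact: rep_node_seq.
exact: rep_edge_list.
Qed.

Lemma connected_correct : implements_connectedsubgraphs connectedsubgraphs.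
Proof.
move=> m e e_sym _ x /rep_graphE[s [us se ->]].
have [t r _] := connectedP (m, map (@pair_val _ _) s).
exists (enc (connected_list m (map (@pair_val _ _) s))), t; split=> //.
exact: rep_connected_list.
Qed.

Lemma collect_correct : collects_constraints collect.
Proof.
move=> I ns a b nsP /rep_nodeE[nl -> nlP] [Ss [uSs SsE /(rep_constraint_list nlP)[Vs -> VsP]]].
have [t r _] := collectP (nl, Vs).
exists (enc (constraint_list (nl, Vs))), t; split=> //.
exact: rep_constraint_seq VsP.
Qed.

(** Valid for every instance: with the number of connected sets kept as a parameter, each of the two
    conditions only has to bound that number. *)
Lemma CONSTRAINT_FIND_time : exists2 q, polynomially_bounded q &
  forall I x, rep_instance I x -> exists y t,
    [/\ run (CONSTRAINT_FIND build connectedsubgraphs collect) x y t,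
        rep_constraints I y & t <= q (ntargets I + nresources I + connected_count I)].
Proof.
(* Bound on the code of an instance: two unary numbers, two pairing nodes and at most [N * N]
   pairs. *)
pose r1 N := 4 * N + 5 + N * N * (4 * N + 4).
have r1P : polynomially_bounded r1 by rewrite /r1; polynomially_bounded.
(* Bound on the measure of the enumeration: the graph is part of the output of [build], and each of
   at most [N + 1] rounds obeys [tree_size_state]. *)
pose mu N := qb (r1 N) + (N + 1) * (N * (2 * N * N + 2 * N + 3) + 1).
have muP : polynomially_bounded mu by rewrite /mu; polynomially_bounded.
exists (fun N => qb (r1 N) + qc (mu N) + ql (qb (r1 N) + qc (mu N) + 1) + 40).
  by polynomially_bounded.
move=> I x xI; have [s [us sI xE]] := rep_instanceE xI.
set K := ntargets I + nresources I + connected_count I.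
pose R := map (@pair_val _ _) s.
have nK : ntargets I <= K by rewrite /K -addnA leq_addr.
have kK : nresources I <= K by rewrite /K addnAC leq_addl.
have MK : connected_count I <= K by rewrite leq_addl.
have inK : tree_size (enc (ntargets I, (nresources I, R))) <= r1 K.
  have -> : tree_size (enc (ntargets I, (nresources I, R))) =
    (tree_size (enc (ntargets I)) + (tree_size (enc (nresources I)) + tree_size (enc R)).+1).+1.
    by [].
  rewrite !tree_size_nat; have := tree_size_pairs us; rewrite -/R => RK.
  have : nresources I * ntargets I * (2 * nresources I + 2 * ntargets I + 4) <=
      K * K * (4 * K + 4) by rewrite leq_mul ?leq_mul //; lia.
  rewrite /r1; lia.
have [t1 [s1 ex1 e1] t1K] := buildP (ntargets I, (nresources I, R)).
have {}t1K := leq_trans t1K (qbP.1 _ _ inK).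
set nl := node_list (ntargets I) (nresources I) R.
pose m := size nl; pose E := edge_list nl.
have bE : enc (build_graph (ntargets I, (nresources I, R))) = Defs.Cons (enc nl) (enc (m, E)).
  by [].
rewrite bE in e1 t1K.
have mE : m = size (node_seq I) by rewrite /m /nl (node_listE sI) size_map.
have [t2 [s2 ex2 e2] t2K] := connectedP (m, E).
have [t3 [s3 ex3 e3] t3K] := collectP (nl, connected_list m E).
have nsP := numbers_node_seq I.
have EE : E = map (@pair_val _ _) (numbered_edges (node_seq I)).
  by rewrite /E /nl (node_listE sI) edge_listE ?nsP.1.
have mK : m <= K by rewrite mE size_node_seq (leq_trans (card_nodes I)).
have muK : tree_size (enc (m, E)) +
    \sum_(i < m.+1) tree_size (enc (iter (m - i) (grow m E) (singletons m))) <= mu K.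
  apply: leq_add; first by move: t1K; rewrite /=; lia.
  apply: (@leq_trans (\sum_(i < m.+1) (K * (2 * K * K + 2 * K + 3) + 1))).
    apply: leq_sum => i _; move: (m - i) => r; rewrite EE mE.
    apply: leq_trans (tree_size_state (@numbered_adjacent_sym _ _) (@mem_numbered_edges _ _) _) _.
    by rewrite addn1 ltnS leq_mul // -mE !leq_add ?leq_mul.
  by rewrite sum_nat_const card_ord leq_mul2r (addn1 K) ltnS mK orbT.
have {}t2K := leq_trans t2K (qcP.1 _ _ muK).
have t3K' : t3 <= ql (qb (r1 K) + qc (mu K) + 1).
  apply: leq_trans (leq_addr _ _) (leq_trans t3K (qlP.1 _ _ _)).
  have -> : tree_size (enc (nl, connected_list m E)) =
    (tree_size (enc nl) + tree_size (enc (connected_list m E))).+1 by [].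
  by move: t1K t2K; rewrite /=; lia.
exists (enc (constraint_list (nl, connected_list m E))).
exists ((1 + t1).+1 + ((2 + t2).+1 + (4 + t3).+1).+1).+1; split; last first.
- by move: t1K t2K; rewrite /=; lia.
(* [collect_correct] supplies some run with a correct result; by determinism it is the timed one. *)
- have [|y [t [[s3' ex3' e3'] yI]]] := collect_correct nsP (rep_node_seq sI)
      (b := enc (connected_list m E)).
    rewrite EE mE; apply: rep_connected_list; first exact: numbered_adjacent_sym.
    exact: mem_numbered_edges.
  by have [ss _] := exec_det ex3 ex3'; rewrite -e3 ss e3'.
exists (upd (upd (upd (upd empty_store 0 x) 1 (s1 0)) 2 (s2 0)) 0 (s3 0)) => //.
apply: ExecSeq; first by apply: (@ExecCall 1 build (EVar 0)); rewrite xE; exact: ex1.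
apply: ExecSeq; first by apply: (@ExecCall 2 _ (ETl (EVar 1))); rewrite /= /upd /= e1; exact: ex2.
by apply: (@ExecCall 0 _ (ECons (EHd (EVar 1)) (EVar 2))); rewrite /upd /= e1 e2; exact: ex3.
Qed.

End Programs.

Lemma polynomially_bounded_pow c d : polynomially_bounded (fun s => c * s.+1 ^ d).
Proof.
split=> [a b ab|]; last by exists c, d.
by rewrite leq_mul2l; case: d => [|d]; rewrite ?orbT // leq_exp2r ?ltnS ?ab ?orbT.
Qed.

(** All vertex sets together number at most [2 ^ #|nodes I|], and 2 to the power c log n is at most
    n to the power c. Below the threshold there are fewer than [n0] nodes, so the constant [2 ^ n0]
    suffices. *)
Lemma connected_count_log (family : instance -> Prop) : log_many_nodes family ->
  exists c d, forall I, family I -> connected_count I <= c * (ntargets I).+1 ^ d.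
Proof.
move=> [c [n0 logP]]; exists (2 ^ n0), c => I famI.
apply: leq_trans (connected_count_exp I) _.
have [nI|nI] := leqP n0 (ntargets I); last first.
  apply: (@leq_trans (2 ^ n0 * 1)); last by rewrite leq_mul2l expn_gt0 orbT.
  by rewrite muln1 leq_exp2l // (leq_trans (card_nodes I)) // ltnW.
apply: (@leq_trans (1 * (ntargets I).+1 ^ c)); last by rewrite leq_mul2r expn_gt0 orbT.
rewrite mul1n; apply: (@leq_trans (2 ^ (c * trunc_log 2 (ntargets I)))).
  by rewrite leq_exp2l //; apply: logP.
have n_gt0 : 0 < ntargets I by apply: leq_trans (nresources_lt I).
rewrite mulnC expnM; case: (c) => // d.
by rewrite leq_exp2r // (leq_trans (trunc_logP _ _)).
Qed.

Lemma connected_count_branching (family : instance -> Prop) :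
    constant_degree_and_branching family ->
  exists c d, forall I, family I -> connected_count I <= c * (ntargets I).+1 ^ d.
Proof.
move=> [D [h famP]]; exists 1, (2 + D * h).+1 => I famI; rewrite mul1n expnS.
have [degD branch] := famP I famI.
apply: leq_trans (connected_count_degree degD branch) _.
by apply: leq_mul; rewrite ?leq_exp2r ?ltnS ?leqW ?card_nodes.
Qed.

Theorem lemma3 :
  exists build connectedsubgraphs collect : com,
    [/\ builds_intersection_graph build,
        implements_connectedsubgraphs connectedsubgraphs
      & collects_constraints collect] /\
    forall family : instance -> Prop,
      log_many_nodes family \/ constant_degree_and_branching family ->
      runs_in_polynomial_time
        (CONSTRAINT_FIND build connectedsubgraphs collect) family.
Proof.
have [build [qb [qbP buildP]]] := polytime_build_graph.
have [connectedsubgraphs [qc [qcP connectedP]]] := polytime_connected_list.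
have [collect [ql [qlP collectP]]] := polytime_constraint_list.
exists build, connectedsubgraphs, collect; split.
  split; [exact: build_correct buildP | exact: connected_correct connectedP |].
  exact: collect_correct collectP.
move=> family famP.
have [q qP timeP] := CONSTRAINT_FIND_time qbP qcP qlP buildP connectedP collectP.
have [c [d countP]] : exists c d, forall I, family I ->
    connected_count I <= c * (ntargets I).+1 ^ d.
  by case: famP => [/connected_count_log|/connected_count_branching].
have powP := polynomially_bounded_pow c d.
have /(polynomially_bounded_comp qP)[_ [c' [d' boundP]]] :
    polynomially_bounded (fun s => s + c * s.+1 ^ d).
  by apply: polynomially_bounded_add => //; apply: polynomially_bounded_id.
(* The required bound has [N] in place of [N.+1]; as k < n, [N] is positive and [N.+1 <= 2 * N],
   which costs the factor [2 ^ d']. *)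
exists (c' * 2 ^ d'), d' => I x famI xI; have [y [t [r yI tle]]] := timeP I x xI.
exists y, t; split=> //; apply: leq_trans tle _.
set N := ntargets I + nresources I.
have N_gt0 : 0 < N by apply: leq_trans (leq_addr _ _); apply: leq_trans (nresources_lt I).
apply: (@leq_trans (q (N + c * N.+1 ^ d))).
  apply: qP.1; rewrite leq_add2l; apply: leq_trans (countP I famI) _.
  by apply: powP.1; apply: leq_addr.
apply: leq_trans (boundP N) _; rewrite -mulnA -expnMn leq_mul2l.
case: d' {boundP} => [|d']; rewrite ?expn0 ?orbT // leq_exp2r ?mul2n -?addnn //.
by rewrite -addn1 leq_add2l N_gt0 orbT.
Qed.
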